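(* Let $\mathfrak{M}$ be a von Neumann algebra and let $A\in\mathfrak{M}$ be a nonzero positive element. If $A$ is well-supported, then $$\sigma_A(T)=\{g(AT): g\in\mathcal{P}_A(T)\}$$ for any $T\in\mathfrak{M}^A$. In particular, if $A=I$, then $$\sigma(T)=\{g(T): g\in\mathcal{P}_I(T)\}$$ for any $T\in\mathfrak{M}$.
   Context: $\mathfrak{M}$ acts on a complex Hilbert space $\mathcal{H}$ and contains the identity $I$. The positive element $A$ is called well-supported if $\sigma(A)\setminus\{0\}$ is closed, equivalently $\sigma(A)\subseteq\{0\}\cup[\alpha,\infty)$ for some $\alpha>0$. For $h\in\mathcal{H}$ put $\|h\|_A=\sqrt{\langle Ah,h\rangle}$, for $T\in\mathfrak{M}$ put $\|T\|_A=\sup\{\|Th\|_A:\|h\|_A=1\}$, and set $\mathfrak{M}^A=\{T\in\mathfrak{M}:\|T\|_A<\infty\}$. $T\in\mathfrak{M}^A$ is $A$-invertible in $\mathfrak{M}^A$ if there is $S\in\mathfrak{M}^A$ with $ATS=AST=A$; the $A$-spectrum is $\sigma_A(T)=\{\lambda\in\mathbb{C}:\lambda I-T\text{ is not }A\text{-invertible in }\mathfrak{M}^A\}$. $\sigma(T)$ is the usual spectrum of $T$ in $\mathfrak{M}$. Let $\mathcal{P}(\mathfrak{M})$ be the set of pure states of $\mathfrak{M}$ and $\mathcal{P}_A(\mathfrak{M})=\{f/f(A): f\in\mathcal{P}(\mathfrak{M}),\ f(A)\neq0\}$. For $T\in\mathfrak{M}^A$ set $\mathcal{P}_A(T)=\mathcal{P}_A^l(T)\cup\mathcal{P}_A^r(T)$,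 where $$\mathcal{P}_A^r(T)=\{\tau\in\mathcal{P}_A(\mathfrak{M}):\tau(ATS)=\tau(AT)\tau(AS)\ \ \forall S\in A^{1/2}\mathfrak{M}A^{1/2}\},$$ $$\mathcal{P}_A^l(T)=\{\tau\in\mathcal{P}_A(\mathfrak{M}):\tau(AST)=\tau(AT)\tau(AS)\ \ \forall S\in A^{1/2}\mathfrak{M}A^{1/2}\}.$$ For $A=I$ this means that $\mathcal{P}_I(T)$ is the set of pure states $\tau$ of $\mathfrak{M}$ such that $\tau(TS)=\tau(T)\tau(S)$ for all $S\in\mathfrak{M}$, or $\tau(ST)=\tau(S)\tau(T)$ for all $S\in\mathfrak{M}$. *)

(* Defs.v *)
From HB Require Import structures.
From mathcomp Require Import all_boot all_order all_algebra.
From mathcomp Require Import all_classical all_reals all_analysis.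
From mathcomp Require Import complex.

Set Implicit Arguments.
Unset Strict Implicit.
Unset Printing Implicit Defensive.

Import Order.TTheory GRing.Theory Num.Theory.
Import numFieldNormedType.Exports.

Local Open Scope classical_set_scope.
Local Open Scope ring_scope.

(** Throughout, a complex Hilbert space is a complete normed module [H] over
    [R[i]] together with a positive definite hermitian form [dot] (linear in its
    first argument) such that [hilbert_dot dot] holds. *)

Section Operators.
Context {R : realType} {H : completeNormedModType R[i]}.
Variable dot : {dot H for Num.conj}.

Local Notation "''[' u , v ]" := (dot u v) : ring_scope.

Definition hilbert_dot : Prop := forall x : H, `|x| ^+ 2 = '[x, x].

Definition bounded_operator (T : H -> H) : Prop :=
  linear T /\ exists c : R, forall h, `|T h| <= (c%:C)%C * `|h|.

Definition is_adjoint (T S : H -> H) : Prop :=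
  forall x y, '[T x, y] = '[x, S y].

(** In [R[i]], [0 <= z] says that [z] is real and nonnegative. *)
Definition positive_operator (T : H -> H) : Prop :=
  bounded_operator T /\ forall h, 0 <= '[T h, h].

(** Closedness in the weak operator topology of the algebra of all bounded
    operators, whose basic neighbourhoods of [T] are given by finitely many
    pairs of vectors and a tolerance. *)
Definition wot_closed (M : set (H -> H)) : Prop :=
  forall T, bounded_operator T ->
    (forall (s : seq (H * H)) (e : R), 0 < e ->
      exists2 S, M S & forall p, p \in s ->
        `|'[T p.1, p.2] - '[S p.1, p.2]| < (e%:C)%C) ->
    M T.

(** Unital, weakly closed *-subalgebras of the bounded operators. An adjoint is
    unique when it exists, so [vna_adj] says that [M] contains the adjoints of
    its elements. *)
Record von_neumann_algebra (M : set (H -> H)) : Prop := {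
  vna_bounded : forall T, M T -> bounded_operator T;
  vna_id : M idfun;
  vna_lin : forall (a : R[i]) S T, M S -> M T -> M (a *: S + T);
  vna_comp : forall S T, M S -> M T -> M (S \o T);
  vna_adj : forall T, M T -> exists2 S, M S & is_adjoint T S;
  vna_closed : wot_closed M }.

Variable M : set (H -> H).

Definition spectrum (T : H -> H) : set R[i] :=
  [set l | ~ exists2 S, M S &
    (l *: (idfun : H -> H) - T) \o S = idfun /\
    S \o (l *: (idfun : H -> H) - T) = idfun].

(** [R[i]^o] carries the usual topology of the complex plane. *)
Definition well_supported (A : H -> H) : Prop :=
  closed (spectrum A `\ 0 : set R[i]^o).

(** The unique positive square root of a positive operator. *)
Definition op_sqrt (A : H -> H) : H -> H :=
  xget (0 : H -> H) [set B | positive_operator B /\ B \o B = A].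

(** [Re] only transports [<A h, h>], real for a positive [A], to the type [R]. *)
Definition Anorm (A : H -> H) (h : H) : R := Num.sqrt (complex.Re '[A h, h]).

Definition Aopnorm (A T : H -> H) : \bar R :=
  ereal_sup [set (Anorm A (T h))%:E | h in [set h | Anorm A h = 1]].

Definition Abounded (A : H -> H) : set (H -> H) :=
  [set T | M T /\ (Aopnorm A T < +oo)%E].

Definition Ainvertible (A T : H -> H) : Prop :=
  exists2 S, Abounded A S & A \o T \o S = A /\ A \o S \o T = A.

Definition Aspectrum (A T : H -> H) : set R[i] :=
  [set l | ~ Ainvertible A (l *: (idfun : H -> H) - T)].

(** A functional on [M] is represented by a function on all maps [H -> H]; only
    its values on [M] are meaningful, hence constrained or compared. *)
Definition state (f : (H -> H) -> R[i]) : Prop :=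
  [/\ forall (a : R[i]) S T, M S -> M T -> f (a *: S + T) = a * f S + f T,
      forall T, M T -> positive_operator T -> 0 <= f T
    & f idfun = 1].

(** Pure states are the extreme points of the set of states. *)
Definition pure_state (f : (H -> H) -> R[i]) : Prop :=
  state f /\
  forall (g h : (H -> H) -> R[i]) (t : R), state g -> state h -> 0 < t < 1 ->
    (forall T, M T -> f T = (t%:C)%C * g T + ((1 - t)%:C)%C * h T) ->
    forall T, M T -> g T = f T /\ h T = f T.

Definition Apure_states (A : H -> H) : set ((H -> H) -> R[i]) :=
  [set (fun T => f T / f A) | f in [set f | pure_state f /\ f A != 0]].

Definition sqrt_corner (A : H -> H) : set (H -> H) :=
  [set op_sqrt A \o X \o op_sqrt A | X in M].

Definition Pr (A T : H -> H) : set ((H -> H) -> R[i]) :=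
  [set tau | Apure_states A tau /\ forall S, sqrt_corner A S ->
    tau (A \o T \o S) = tau (A \o T) * tau (A \o S)].

Definition Pl (A T : H -> H) : set ((H -> H) -> R[i]) :=
  [set tau | Apure_states A tau /\ forall S, sqrt_corner A S ->
    tau (A \o S \o T) = tau (A \o T) * tau (A \o S)].

Definition PA (A T : H -> H) : set ((H -> H) -> R[i]) := Pl A T `|` Pr A T.

End Operators.

(* Main.v *)
From HB Require Import structures.
From mathcomp Require Import all_boot all_order all_algebra.
From mathcomp Require Import all_classical all_reals all_analysis.
From mathcomp Require Import complex ring lra.
Require Import Defs.

Set Implicit Arguments.
Unset Strict Implicit.
Unset Printing Implicit Defensive.

Import Order.TTheory GRing.Theory Num.Theory.
Import numFieldNormedType.Exports.

Local Open Scope classical_set_scope.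
Local Open Scope ring_scope.

Local Notation "a *r x" := (a%:C%C *: x) (at level 40) : ring_scope.
Local Notation Re := complex.Re.
Local Notation Im := complex.Im.

(** Let [E] be the projection onto the kernel of [A] and [P = 1 - E]. When [A] is
    well-supported there is a positive invertible [C] in the algebra, commuting
    with [E], such that [A = C^2 P]; let [D] be its inverse. Then [C P] is the
    square root of [A] and [D P] its pseudo-inverse ([gap_structure],
    [op_sqrt_eq]). An [A]-bounded [T] maps the kernel of [A] into itself
    ([Abounded_ker]), so that it acts on the range of [P] through the element
    [W = D A T D = C P T D]. Put [N = l P + E - W]. If [N] is invertible in the
    algebra, with inverse [L], then [D L C] is an [A]-inverse of [l - T]
    ([Ainvertible_of_inverse]).

    Suppose that [l] belongs to the [A]-spectrum. Then [N] is not invertible,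
    hence one of the positive operators [N' N] and [N N'], where [N'] is the
    adjoint of [N], is not bounded below: an operator of the algebra which is
    bounded below and self-adjoint is inverted by a Neumann series
    ([inverse_of_below]). A positive element [K] that is not bounded below is
    annihilated by a pure state [psi]: vector states make the value at [K]
    arbitrarily small, the states at which it is smallest form a closed face of
    the compact set of states, and such a face contains an extreme point
    ([pure_state_vanishing]). By the Cauchy-Schwarz inequality [psi] vanishes on
    all [Y N], or on all [N Y] ([state_null]), in particular on [E = E N = N E],
    so that [psi(W) = l] and [psi] is multiplicative on the products [V W], or
    [W V], with [V] supported on [P]. As [D] is invertible,
    [f(X) = psi(D X D) / psi(D D)] is again a pure state ([compress_pure]), and
    [g = f / f(A)] is [X |-> psi(D X D)]. For [S0] in the corner of [A] and
    [V = D A S0 D] one has [D A S0 T D = V W] and [D A T S0 D = W V]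
    ([corner_products]), which is the membership of [g] in the left or right
    part of the set of states attached to [T], and [g(A T) = psi(W) = l].

    Conversely let [S] be an [A]-inverse of [l - T]. The element [S0 = P S P]
    lies in the corner of [A], and [A T S0] and [A S0 T] are both equal to
    [l A S0 - A]; for [g] with [g(A T) = l] either multiplicativity condition
    reads [l g(A S0) - 1 = l g(A S0)], a contradiction ([PA_not_Ainvertible]).

    The structure of [A] is obtained by hand. The gap of the spectrum above [0] gives
    [al <A h, h> <= |A h|^2] because [(A - t)^2 - m] factors into two invertible
    operators when [t = al/2] and [m < t^2] ([gap_of_resolvent]). On the range
    of [A] the operator [1 - A/c] is then a strict contraction, so that its
    powers converge in norm to [E]; the square root comes from a contraction as
    well ([sqrt_one_sub]).

    The second statement is the case [A = 1] of the first, except on the zero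
    space, where both sides are empty. *)

(** * Complex numbers, linear maps and the real inner product *)

Section Linear.
Context {R : realType} {V : lmodType R[i]}.
Variables (T : V -> V) (hT : linear T).

Lemma linD x y : T (x + y) = T x + T y.
Proof. by have := hT 1 x y; rewrite !scale1r. Qed.
Lemma lin0 : T 0 = 0.
Proof. by apply: (addrI (T 0)); rewrite -linD !addr0. Qed.
Lemma linZ a x : T (a *: x) = a *: T x.
Proof. by have := hT a x 0; rewrite lin0 !addr0. Qed.
Lemma linN x : T (- x) = - T x.
Proof. by rewrite -scaleN1r linZ scaleN1r. Qed.
Lemma linB x y : T (x - y) = T x - T y.
Proof. by rewrite linD linN. Qed.
End Linear.

Section ComplexRe.
Context {R : realType}.
Implicit Types (z w : R[i]).
Lemma cReD z w : Re (z + w) = Re z + Re w. Proof. by case: z w => ? ? []. Qed.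
Lemma cImD z w : Im (z + w) = Im z + Im w. Proof. by case: z w => ? ? []. Qed.
Lemma cReN z : Re (- z) = - Re z. Proof. by case: z. Qed.
Lemma cReM z w : Re (z * w) = Re z * Re w - Im z * Im w.
Proof. by case: z w => ? ? []. Qed.
Lemma cImM z w : Im (z * w) = Re z * Im w + Im z * Re w.
Proof. by case: z w => ? ? []. Qed.
Lemma cReZ (a : R) z : Re (a%:C%C * z) = a * Re z.
Proof. by rewrite cReM /= mul0r subr0. Qed.
Lemma complex_ext z w : Re z = Re w -> Im z = Im w -> z = w.
Proof. by case: z w => ? ? [? ?] /= -> ->. Qed.
Lemma ge0_ReIm z : (0 <= z) = (0 <= Re z) && (Im z == 0).
Proof. by rewrite lecE /= andbC. Qed.
End ComplexRe.

Section Hilbert.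
Context {R : realType} {H : completeNormedModType R[i]}.
Variables (dot : {dot H for Num.conj}) (hdot : hilbert_dot dot).
Implicit Types (x y h : H) (S T : H -> H) (a b k : R).

(** A complex-linear operator is self-adjoint for the hermitian form as soon as
    it is symmetric for its real part, and positivity only concerns this real
    part: the space is treated as a real Hilbert space with complex-linear
    operators, where order reasoning takes place in [R]. *)
Definition rdot x y : R := Re (dot x y).
Definition rnorm x : R := Re `|x|.

Lemma rdotE x y : rdot x y = Re (dot x y). Proof. by []. Qed.

Lemma dotC x y : dot x y = ((dot y x)^*)%C.
Proof. by rewrite (hermC dot) expr0 mul1r. Qed.

Lemma dotDl x y h : dot (x + y) h = dot x h + dot y h.
Proof. by rewrite linearDl. Qed.
Lemma dotZl (a : R[i]) x h : dot (a *: x) h = a * dot x h.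
Proof. by rewrite linearZl_LR. Qed.
Lemma dotDr x y h : dot h (x + y) = dot h x + dot h y.
Proof. by rewrite linearDr. Qed.
Lemma dotZr (a : R[i]) x h : dot h (a *: x) = a^*%C * dot h x.
Proof. by rewrite linearZr_LR. Qed.

Lemma rdotC x y : rdot x y = rdot y x.
Proof. by rewrite /rdot dotC; case: (dot y x). Qed.

Lemma rdotDl x y h : rdot (x + y) h = rdot x h + rdot y h.
Proof. by rewrite /rdot linearDl cReD. Qed.
Lemma rdotNl x h : rdot (- x) h = - rdot x h.
Proof. by rewrite /rdot linearNl cReN. Qed.
Lemma rdotZl a x h : rdot (a *r x) h = a * rdot x h.
Proof. by rewrite /rdot linearZl_LR /= cReZ. Qed.
Lemma rdotBl x y h : rdot (x - y) h = rdot x h - rdot y h.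
Proof. by rewrite rdotDl rdotNl. Qed.
Lemma rdotDr x y h : rdot h (x + y) = rdot h x + rdot h y.
Proof. by rewrite rdotC rdotDl !(rdotC h). Qed.
Lemma rdotNr x h : rdot h (- x) = - rdot h x.
Proof. by rewrite rdotC rdotNl !(rdotC h). Qed.
Lemma rdotZr a x h : rdot h (a *r x) = a * rdot h x.
Proof. by rewrite rdotC rdotZl !(rdotC h). Qed.
Lemma rdotBr x y h : rdot h (x - y) = rdot h x - rdot h y.
Proof. by rewrite rdotDr rdotNr. Qed.
Lemma rdot0l h : rdot 0 h = 0.
Proof. by have := rdotDl 0 0 h; rewrite addr0; lra. Qed.
Lemma rdot0r h : rdot h 0 = 0.
Proof. by rewrite rdotC rdot0l. Qed.

Lemma Im_dot x y : Im (dot x y) = rdot x ('i%C *: y).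
Proof.
rewrite /rdot linearZr_LR /=.
by case: (dot x y) => a b; rewrite cReM /=; lra.
Qed.

Lemma normE x : `|x| = (rnorm x)%:C%C.
Proof. by apply: complex_ext => //=; apply: ger0_Im. Qed.

Lemma rnorm_ge0 x : 0 <= rnorm x.
Proof. by have := normr_ge0 x; rewrite normE ler0c. Qed.

Lemma rnorm_sqr x : rnorm x ^+ 2 = rdot x x.
Proof. by rewrite /rdot -hdot normE -rmorphXn. Qed.

Lemma dot_diag x : dot x x = (rnorm x ^+ 2)%:C%C.
Proof. by rewrite -hdot normE rmorphXn. Qed.

Lemma rnorm_eq0 x : rnorm x = 0 -> x = 0.
Proof. by move=> h; apply/eqP; rewrite -normr_eq0 normE h. Qed.

Lemma rnorm0 : rnorm 0 = 0. Proof. by rewrite /rnorm normr0. Qed.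

Lemma rnorm_gt0 x : x <> 0 -> 0 < rnorm x.
Proof. by move=> x0; rewrite lt0r rnorm_ge0 andbT; apply/eqP => /rnorm_eq0. Qed.

Lemma rnormD x y : rnorm (x + y) <= rnorm x + rnorm y.
Proof. by have := ler_normD x y; rewrite !normE -rmorphD /= lecR. Qed.

Lemma rnormN x : rnorm (- x) = rnorm x. Proof. by rewrite /rnorm normrN. Qed.

Lemma rnormB x y : rnorm (x - y) <= rnorm x + rnorm y.
Proof. by rewrite (le_trans (rnormD _ _))// rnormN. Qed.

Lemma rnormZc (a : R[i]) x : rnorm (a *: x) = Re `|a| * rnorm x.
Proof.
have aE : `|a| = (Re `|a|)%:C%C by apply: complex_ext => //=; apply: ger0_Im.
by rewrite {1}/rnorm normrZ aE normE -rmorphM /=.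
Qed.

Lemma rnormZ a x : rnorm (a *r x) = `|a| * rnorm x.
Proof.
rewrite rnormZc; congr (_ * _); rewrite normc_def /=.
by rewrite expr0n addr0 sqrtr_sqr.
Qed.

Lemma rdot_ge0 x : 0 <= rdot x x.
Proof. by rewrite -rnorm_sqr sqr_ge0. Qed.

Definition bounded_by T k := forall h, rnorm (T h) <= k * rnorm h.
Definition selfadj T := forall x y, rdot (T x) y = rdot x (T y).
Definition nonneg T := forall h, 0 <= rdot (T h) h.

Lemma bounded_operator_bound T : bounded_operator T -> linear T /\ exists2 k, 0 <= k & bounded_by T k.
Proof.
move=> [lT [k hk]]; split=> //; exists (Num.max k 0); first by rewrite le_max lexx orbT.
move=> h; have := hk h; rewrite !normE -rmorphM /= lecR => /le_trans; apply.
by rewrite ler_wpM2r ?rnorm_ge0// le_max lexx.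
Qed.

Lemma bounded_by_operator T k : linear T -> bounded_by T k -> bounded_operator T.
Proof.
move=> lT hk; split=> //; exists k => h.
by rewrite !normE -rmorphM /= lecR.
Qed.

Lemma selfadj_adjoint T : linear T -> selfadj T -> is_adjoint dot T T.
Proof.
move=> lT sT x y; apply: complex_ext; first exact: sT.
rewrite !Im_dot -(linZ lT). exact: sT.
Qed.

(** Polarization: [<T h, h>] is real for every [h], in particular at [x + y] with
    [y] multiplied by [i]. *)
Lemma positive_selfadj T : positive_operator dot T -> selfadj T.
Proof.
move=> [[lT _] pT].
have im0 h : rdot (T h) ('i%C *: h) = 0.
  by rewrite -Im_dot; have := pT h; rewrite ge0_ReIm => /andP[_ /eqP].
have pol x y : rdot (T x) ('i%C *: y) + rdot (T y) ('i%C *: x) = 0.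
  have := im0 (x + y); rewrite (linD lT) scalerDr !(rdotDl, rdotDr) !im0; lra.
move=> x y; have := pol x ('i%C *: y).
rewrite -!Im_dot (linZ lT) linearZl_LR linearZr_LR /= !cImM /= [rdot x _]rdotC /rdot.
by move=> e; lra.
Qed.

Lemma positive_nonneg T : positive_operator dot T -> nonneg T.
Proof. by move=> [_ pT] h; have := pT h; rewrite ge0_ReIm => /andP[]. Qed.

Lemma nonneg_positive T : bounded_operator T -> selfadj T -> nonneg T ->
  positive_operator dot T.
Proof.
move=> bT sT pT; split=> // h; rewrite ge0_ReIm; apply/andP; split; first exact: pT.
have := selfadj_adjoint (bounded_operator_bound bT).1 sT h h; rewrite [RHS]dotC.
case: (dot (T h) h) => a b [] hb /=; apply/eqP; lra.
Qed.

Lemma nonneg_CS T : linear T -> selfadj T -> nonneg T -> forall x y,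
  rdot (T x) y ^+ 2 <= rdot (T x) x * rdot (T y) y.
Proof.
move=> lT sT pT x y.
set a := rdot (T x) x; set b := rdot (T x) y; set c := rdot (T y) y.
have q s t : 0 <= s ^+ 2 * a + 2 * s * t * b + t ^+ 2 * c.
  have := pT (s *r x + t *r y).
  rewrite (linD lT) !(linZ lT) !(rdotDl, rdotDr) !(rdotZl, rdotZr).
  rewrite [rdot (T y) x]rdotC -(sT x y) -/a -/b -/c; lra.
have a0 : 0 <= a := pT x. have c0 : 0 <= c := pT y.
have [c00|cn0] := eqVneq c 0.
  have [->|bn0] := eqVneq b 0; first by rewrite expr0n /= mulr_ge0.
  have := q 1 (- (a + 1) / (2 * b)).
  rewrite c00 mulr0 addr0.
  have -> : 2 * 1 * (- (a + 1) / (2 * b)) * b = - (a + 1) by field.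
  lra.
have cp : 0 < c by rewrite lt0r cn0.
have := q c (- b).
have -> : c ^+ 2 * a + 2 * c * - b * b + (- b) ^+ 2 * c = c * (a * c - b ^+ 2) by ring.
by rewrite pmulr_rge0// subr_ge0.
Qed.

Lemma CS x y : `|rdot x y| <= rnorm x * rnorm y.
Proof.
have lid : linear (idfun : H -> H) by [].
have := nonneg_CS lid (fun x y => erefl) rdot_ge0 x y; rewrite /= -!rnorm_sqr -exprMn => h.
by rewrite -ler_sqr ?nnegrE ?mulr_ge0 ?rnorm_ge0// -normrX ger0_norm// sqr_ge0.
Qed.

(** Cauchy-Schwarz for the form [<T ., .>], applied to [h] and [T h]. *)
Lemma nonneg_sqr_le T k : linear T -> selfadj T -> nonneg T ->
  (forall h, rdot (T h) h <= k * rdot h h) ->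
  forall h, rdot (T h) (T h) <= k * rdot (T h) h.
Proof.
move=> lT sT pT hk h; have := nonneg_CS lT sT pT h (T h).
set a := rdot (T h) (T h) => ha.
have a0 : 0 <= a := rdot_ge0 _.
have [->|an0] := eqVneq a 0.
  have [k0|k0] := leP 0 k; first by rewrite mulr_ge0.
  have := hk h; have := pT h; have := rdot_ge0 h; nra.
have ap : 0 < a by rewrite lt0r an0.
have := hk (T h); rewrite -/a => hk'; have := pT h => p.
rewrite -(ler_pM2r ap); nra.
Qed.

Lemma bounded_by_rdot T k : bounded_by T k -> forall h, `|rdot (T h) h| <= k * rdot h h.
Proof.
move=> hk h; rewrite (le_trans (CS _ _))// -rnorm_sqr expr2 mulrA.
by rewrite ler_wpM2r ?rnorm_ge0.
Qed.

Lemma bounded_by_comp S T k l : 0 <= k -> bounded_by S k -> bounded_by T l -> bounded_by (S \o T) (k * l).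
Proof.
by move=> k0 hS hT h /=; rewrite (le_trans (hS _))// -mulrA ler_wpM2l.
Qed.

Lemma bounded_by_lin (c : R[i]) S T k l : bounded_by S k -> bounded_by T l ->
  bounded_by (c *: S + T) (Re `|c| * k + l).
Proof.
move=> hS hT h /=; rewrite mulrDl (le_trans (rnormD _ _))// lerD//.
rewrite rnormZc -mulrA ler_wpM2l//.
by have := normr_ge0 c; rewrite ge0_ReIm => /andP[].
Qed.

End Hilbert.

(** * Limits of operators and contractions *)

Section Limits.
Context {R : realType}.

Lemma le_of_eps (x y k : R) : 0 <= k -> (forall e, 0 < e -> x <= y + e * k) -> x <= y.
Proof.
move=> k0 h; apply/ler_addgt0Pr => e e0.
have k1 : 0 < k + 1 by lra.
apply: le_trans (h (e / (k + 1)) (divr_gt0 e0 k1)) _.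
rewrite lerD2l mulrAC ler_pdivrMr// ler_wpM2l ?ltW//; lra.
Qed.

Lemma eq0_of_eps (x k : R) : 0 <= k -> 0 <= x -> (forall e, 0 < e -> x <= e * k) -> x = 0.
Proof.
move=> k0 x0 h; apply/eqP; rewrite eq_le x0 andbT; apply: (@le_of_eps _ _ k) => // e e0.
by rewrite add0r h.
Qed.

Lemma geometric_small (q K e : R) : 0 <= q < 1 -> 0 < e -> 0 <= K ->
  exists N, forall n, (N <= n)%N -> K * q ^+ n <= e.
Proof.
move=> /andP[q0 q1] e0 K0.
have K1 : 0 < K + 1 by lra.
have /cvgrPdist_lt/(_ (e / (K + 1)) (divr_gt0 e0 K1))[N _ hN] :
  (GRing.exp q : R^nat) x @[x --> \oo] --> 0 by apply: cvg_expr; rewrite ger0_norm.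
exists N => n /hN /=; rewrite sub0r normrN ger0_norm ?exprn_ge0//.
rewrite ltr_pdivlMr// => hq; have := exprn_ge0 n q0; nra.
Qed.

Context {H : completeNormedModType R[i]}.
Implicit Types (u : nat -> H).

Lemma complete_seq u :
  (forall e, 0 < e -> exists N, forall n, (N <= n)%N -> rnorm (u n - u N) <= e) ->
  exists l, forall e, 0 < e -> exists N, forall n, (N <= n)%N -> rnorm (l - u n) <= e.
Proof.
move=> hu.
have cu : cvg (u @ \oo).
  apply/cauchy_cvgP/cauchy_exP => e e0.
  have e0' : 0 < Re e by move: e0; rewrite ltcE => /andP[].
  have [N hN] := hu (Re e / 2) ltac:(lra).
  exists (u N); rewrite -ball_normE /=; exists N => //= n /= Nn.
  rewrite -opprB normrN normE ltcE /=.
  have -> : Im e = 0 by apply: ger0_Im; exact: ltW.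
  by rewrite eqxx /= (le_lt_trans (hN _ Nn))//; lra.
exists (limn u) => e e0.
have /cvgrPdist_lt/(_ (e%:C)%C) := cu.
rewrite ltcR => /(_ e0)[N _ hN]; exists N => n Nn.
by have := hN _ Nn; rewrite /= normE ltcR => /ltW.
Qed.
End Limits.

Section Limits2.
Context {R : realType} {H : completeNormedModType R[i]}.
Implicit Types (S T L : H -> H).

(** The limit is taken pointwise; the geometric rate makes it uniform on the unit
    ball. *)
Lemma geometric_limit (T : nat -> H -> H) (K q : R) : 0 <= q < 1 -> 0 <= K ->
  (forall n, linear (T n)) ->
  (forall n, bounded_by (T n.+1 - T n) (K * q ^+ n)) ->
  exists2 L, linear L & forall e, 0 < e -> exists N, forall n, (N <= n)%N ->
    bounded_by (L - T n) e.
Proof.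
move=> q01 K0 lT hT; have /andP[q0 q1] := q01.
have tele h n m : rnorm (T (n + m)%N h - T n h) <= K * q ^+ n * (1 - q ^+ m) / (1 - q) * rnorm h.
  elim: m => [|m IH]; first by rewrite addn0 subrr rnorm0 expr0 subrr mulr0 mul0r mul0r.
  have -> : T (n + m.+1)%N h - T n h =
    (T (n + m).+1 h - T (n + m)%N h) + (T (n + m)%N h - T n h).
    by rewrite addrA subrK addnS.
  apply: le_trans (rnormD _ _) _; apply: le_trans (lerD (hT _ h) IH) _.
  rewrite -mulrDl ler_wpM2r ?rnorm_ge0// exprD exprS.
  by rewrite le_eqVlt; apply/orP; left; apply/eqP; field; lra.
have c0 : 0 <= K / (1 - q) by rewrite divr_ge0//; lra.
have tele' h n m : (n <= m)%N -> rnorm (T m h - T n h) <= K / (1 - q) * q ^+ n * rnorm h.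
  move=> /subnKC <-; apply: le_trans (tele _ _ _) _.
  rewrite ler_wpM2r ?rnorm_ge0// [leRHS]mulrAC ler_wpM2r ?invr_ge0; [lra| |].
    lra.
  by rewrite ler_piMr ?mulr_ge0 ?exprn_ge0// gerBl exprn_ge0.
have /choice[L hL] : forall h, exists l, forall e, 0 < e ->
    exists N, forall n, (N <= n)%N -> rnorm (l - T n h) <= e.
  move=> h; apply: complete_seq => e e0.
  have [N hN] := geometric_small q01 e0 (mulr_ge0 c0 (rnorm_ge0 h)).
  exists N => n Nn; apply: le_trans (tele' h N n Nn) _.
  by rewrite mulrAC hN.
have bL n : bounded_by (L - T n) (K / (1 - q) * q ^+ n).
  move=> h; apply: (@le_of_eps _ _ _ 1) => // e e0.
  have [N hN] := hL h e e0.
  have -> : (L - T n) h = (L h - T (maxn N n) h) + (T (maxn N n) h - T n h).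
    by rewrite addrA subrK.
  apply: le_trans (rnormD _ _) _; rewrite mulr1 addrC lerD//.
    by apply: tele'; exact: leq_maxr.
  by apply: hN; exact: leq_maxl.
exists L.
  move=> a x y; apply/eqP; rewrite -subr_eq0; apply/eqP/rnorm_eq0.
  have a0 : 0 <= Re `|a| by have := normr_ge0 a; rewrite ge0_ReIm => /andP[].
  apply: (@eq0_of_eps _ _ (rnorm (a *: x + y) + (Re `|a| * rnorm x + rnorm y))).
  - by rewrite !addr_ge0 ?mulr_ge0 ?rnorm_ge0.
  - exact: rnorm_ge0.
  move=> e e0; have [N /(_ N (leqnn _)) hN] := geometric_small q01 e0 c0.
  have hb h : rnorm (L h - T N h) <= e * rnorm h.
    by apply: le_trans (bL N h) _; rewrite ler_wpM2r ?rnorm_ge0.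
  have -> : L (a *: x + y) - (a *: L x + L y) =
    (L (a *: x + y) - T N (a *: x + y)) - (a *: (L x - T N x) + (L y - T N y)).
    by rewrite lT scalerBr addrACA -opprD opprB addrA subrK.
  apply: le_trans (rnormB _ _) _; rewrite mulrDr lerD//.
  apply: le_trans (rnormD _ _) _; rewrite mulrDr lerD// rnormZc mulrCA ler_wpM2l//.
move=> e e0; have [N hN] := geometric_small q01 e0 c0.
exists N => n Nn h; apply: le_trans (bL n h) _.
by rewrite ler_wpM2r ?rnorm_ge0 ?hN.
Qed.

End Limits2.

Section Algebras.
Context {R : realType} {H : completeNormedModType R[i]}.
Implicit Types (S T L : H -> H) (N : set (H -> H)).

Definition norm_closed N := forall L, bounded_operator L ->
  (forall e : R, 0 < e -> exists2 S, N S & bounded_by (L - S) e) -> N L.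

(** Adjoints are left out so that the commutant of a single operator qualifies:
    operators are constructed in the algebra generated by [A], and belong
    therefore both to the von Neumann algebra and to suitable commutants. *)
Record closed_algebra N : Prop := {
  ca_bd : forall T, N T -> bounded_operator T;
  ca_id : N idfun;
  ca_lin : forall (a : R[i]) S T, N S -> N T -> N (a *: S + T);
  ca_comp : forall S T, N S -> N T -> N (S \o T);
  ca_cl : norm_closed N }.

Section Ops.
Variables (N : set (H -> H)) (cN : closed_algebra N).

Lemma ca_0 : N 0.
Proof.
have := ca_lin cN (-1) (ca_id cN) (ca_id cN).
by rewrite scaleN1r addNr.
Qed.
Lemma ca_Z a T : N T -> N (a *: T).
Proof. by move=> NT; have := ca_lin cN a NT ca_0; rewrite addr0. Qed.
Lemma ca_D S T : N S -> N T -> N (S + T).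
Proof. by move=> NS NT; have := ca_lin cN 1 NS NT; rewrite scale1r. Qed.
Lemma ca_B S T : N S -> N T -> N (S - T).
Proof. by move=> NS NT; rewrite -scaleN1r addrC; apply: (ca_lin cN). Qed.
Lemma ca_linear T : N T -> linear T.
Proof. by move/(ca_bd cN) => []. Qed.
End Ops.

Lemma bounded_by_near T L (k e : R) : bounded_by T k -> bounded_by (L - T) e -> bounded_by L (e + k).
Proof.
move=> hT hL h; have := rnormD ((L - T) h) (T h); rewrite /= subrK => /le_trans; apply.
by rewrite mulrDl lerD.
Qed.

(** Banach's fixed point theorem on the ball of radius [r] of a norm-closed set of
    operators; [N] is a mere set because the square root is found among the
    self-adjoint elements, which do not form an algebra. *)
Lemma contraction_fixpoint N (Phi : (H -> H) -> H -> H) (q r : R) :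
  0 <= q < 1 -> 0 <= r -> N 0 -> norm_closed N ->
  (forall T, N T -> bounded_operator T) ->
  (forall T, N T -> bounded_by T r -> N (Phi T) /\ bounded_by (Phi T) r) ->
  (forall S T k, N S -> N T -> bounded_by S r -> bounded_by T r -> 0 <= k -> bounded_by (S - T) k ->
     bounded_by (Phi S - Phi T) (q * k)) ->
  exists Y, [/\ N Y, bounded_by Y r & Phi Y = Y].
Proof.
move=> q01 r0 N0 clN bN stab contr; have /andP[q0 q1] := q01.
pose Y n := iter n Phi 0.
have Yn n : N (Y n) /\ bounded_by (Y n) r.
  elim: n => [|n [Nn bn]]; last exact: stab.
  by split=> // h; rewrite rnorm0 mulr_ge0 ?rnorm_ge0.
have dY n : bounded_by (Y n.+1 - Y n) (r * q ^+ n).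
  elim: n => [|n IH].
    by rewrite expr0 mulr1 /= subr0; apply: (stab _ N0 (Yn 0%N).2).2.
  have [N1 B1] := Yn n.+1; have [N2 B2] := Yn n; rewrite exprS mulrCA.
  by apply: contr => //; rewrite mulr_ge0 ?exprn_ge0.
have [L lL hL] := geometric_limit q01 r0 (fun n => (bN _ (Yn n).1).1) dY.
have bL : bounded_by L r.
  move=> h; apply: (@le_of_eps _ _ _ (rnorm h) (rnorm_ge0 h)) => e e0.
  have [n /(_ n (leqnn n)) hn] := hL e e0.
  by have := bounded_by_near (Yn n).2 hn h; rewrite mulrDl addrC.
have NL : N L.
  apply: clN; first exact: bounded_by_operator lL bL.
  move=> e e0; have [n /(_ n (leqnn n)) hn] := hL e e0.
  by exists (Y n) => //; exact: (Yn n).1.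
exists L; split=> //; apply/funext => h; apply/eqP; rewrite -subr_eq0; apply/eqP/rnorm_eq0.
apply: (@eq0_of_eps _ _ ((q + 1) * rnorm h)); rewrite ?mulr_ge0 ?rnorm_ge0 ?addr_ge0//.
move=> e e0; have [n hn] := hL e e0.
have h1 := contr L (Y n) e NL (Yn n).1 bL (Yn n).2 (ltW e0) (hn n (leqnn n)) h.
have h2 := hn n.+1 (leqnSn n) h.
have -> : Phi L h - L h = (Phi L - Phi (Y n)) h - (L - Y n.+1) h.
  by rewrite /= opprB addrA subrK.
by apply: le_trans (rnormB _ _) _; rewrite mulrA mulrDr mulr1 [e * q]mulrC mulrDl lerD.
Qed.

(** The Neumann series, as the fixed point of [S |-> 1 + X S]. *)
Lemma one_sub_inverse N X (q : R) : closed_algebra N -> N X -> 0 <= q < 1 -> bounded_by X q ->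
  exists2 S, N S & S \o (idfun - X) = idfun /\ (idfun - X) \o S = idfun.
Proof.
move=> cN NX q01 bX; have /andP[q0 q1] := q01.
have lX := ca_linear cN NX.
have r0 : 0 <= 1 / (1 - q) by rewrite divr_ge0//; lra.
have [||S [NS _ fS]] := @contraction_fixpoint N (fun S => idfun + (X \o S)) q (1 / (1 - q))
   q01 r0 (ca_0 cN) (@ca_cl _ cN) (@ca_bd _ cN).
- move=> T NT bT; split; first by apply: (ca_D cN (ca_id cN)); exact: ca_comp.
  move=> h /=; apply: le_trans (rnormD _ _) _.
  apply: le_trans (lerD (lexx _) (bounded_by_comp q0 bX bT h)) _.
  by rewrite le_eqVlt; apply/orP; left; apply/eqP; field; lra.
- move=> S T k NS NT _ _ k0 hST h.
  change (rnorm (h + X (S h) - (h + X (T h))) <= q * k * rnorm h).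
  have -> : h + X (S h) - (h + X (T h)) = X (S h - T h).
    by rewrite (linB lX) opprD addrACA subrr add0r.
  exact: (bounded_by_comp q0 bX hST).
have RS : (idfun - X) \o S = idfun.
  apply/funext => h; change (S h - X (S h) = h).
  by rewrite -[X in X - _ = _](congr1 (@^~ h) fS) /= addrK.
exists S => //; split=> //.
(* [1 - X] is injective, so that a right inverse is a left inverse *)
apply/funext => h; change (S (h - X h) = h).
set w := S _.
have e : w - X w = h - X h := congr1 (@^~ (h - X h)) RS.
apply/eqP; rewrite -subr_eq0; apply/eqP; set v := w - h.
have Xv : X v = v.
  rewrite /v (linB lX); move/eqP: e; rewrite subr_eq => /eqP e.
  by rewrite [in RHS]e -[h - _ + _]addrA [RHS]addrC addKr addrC.
apply: rnorm_eq0; have := bX v; rewrite Xv; have := rnorm_ge0 v; nra.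
Qed.

End Algebras.

(** * Norm-closed algebras of operators *)

Section Structure.
Context {R : realType} {H : completeNormedModType R[i]}.
Variables (dot : {dot H for Num.conj}) (hdot : hilbert_dot dot).
Implicit Types (x y h : H) (S T L : H -> H) (N : set (H -> H)).
Local Notation rdot := (rdot dot).
Local Notation selfadj := (selfadj dot).
Local Notation nonneg := (nonneg dot).

Lemma rdot_ext x y : (forall h, rdot x h = rdot y h) -> x = y.
Proof.
move=> e; apply/eqP; rewrite -subr_eq0; apply/eqP/rnorm_eq0/eqP.
by rewrite -sqrf_eq0 (rnorm_sqr hdot) rdotBl !e subrr.
Qed.

(** The factor 2 comes from bounding the real and imaginary parts separately. *)
Lemma norm_dot_le x y : Re `|dot x y| <= 2 * (rnorm x * rnorm y).
Proof.
have lRI (z : R[i]) : Re `|z| <= `|Re z| + `|Im z|.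
  rewrite normc_def /= -(ger0_norm (addr_ge0 (normr_ge0 (Re z)) (normr_ge0 (Im z)))).
  rewrite -sqrtr_sqr ler_wsqrtr// sqrrD !real_normK ?num_real//.
  by rewrite addrAC lerDl mulrn_wge0// mulr_ge0.
apply: le_trans (lRI _) _; rewrite Im_dot mulr2n mulrDl !mul1r lerD//.
  exact: CS hdot _ _.
apply: le_trans (CS hdot _ _) _; rewrite rnormZc.
have -> : Re `|('i%C : R[i])| = 1 by rewrite normc_def /= expr0n expr1n add0r sqrtr1.
by rewrite mul1r.
Qed.

(** Uniform approximation is stronger than approximation in the weak operator
    topology. *)
Lemma vna_closed_algebra M : von_neumann_algebra dot M -> closed_algebra M.
Proof.
case=> bM iM lM cM aM clM; split=> // L bL hL; apply: clM => // s e e0.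
have [K K0 hK] : exists2 K, 0 <= K & forall p, p \in s -> rnorm p.1 * rnorm p.2 <= K.
  elim: s => [|p s [K K0 IH]]; first by exists 0.
  exists (Num.max K (rnorm p.1 * rnorm p.2)); first by rewrite le_max K0.
  move=> p'; rewrite inE => /orP[/eqP ->|/IH h]; rewrite le_max ?lexx ?orbT//.
  by rewrite h.
have K1 : 0 < 2 * (K + 1) by lra.
have [S MS hS] := hL _ (divr_gt0 e0 K1); exists S => // p /hK hp.
have -> : dot (L p.1) p.2 - dot (S p.1) p.2 = dot ((L - S) p.1) p.2 by rewrite linearBl.
set z := dot _ _.
have -> : `|z| = (Re `|z|)%:C%C by apply: complex_ext => //=; apply: ger0_Im.
rewrite ltcR; apply: le_lt_trans (norm_dot_le _ _) _.
have := hS p.1 => h.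
apply: (@le_lt_trans _ _ (2 * (e / (2 * (K + 1)) * K))).
  rewrite ler_pM2l//; apply: le_trans (ler_wpM2r (rnorm_ge0 _) h) _.
  by rewrite -[leLHS]mulrA ler_wpM2l// divr_ge0; lra.
have -> : 2 * (e / (2 * (K + 1)) * K) = e * K / (K + 1) by field; lra.
rewrite ltr_pdivrMr; nra.
Qed.

Lemma bounded_closed_algebra : closed_algebra (@bounded_operator R H).
Proof.
split=> //.
- by apply: (@bounded_by_operator _ _ _ 1) => // h; rewrite mul1r.
- move=> a S T /bounded_operator_bound[lS [k k0 hS]] /bounded_operator_bound[lT [l l0 hT]].
  apply: bounded_by_operator (bounded_by_lin a hS hT) => c x y.
  change (a *: S (c *: x + y) + T (c *: x + y) =
    c *: (a *: S x + T x) + (a *: S y + T y)).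
  by rewrite lS lT !scalerDr !scalerA mulrC addrACA.
- move=> S T /bounded_operator_bound[lS [k k0 hS]] /bounded_operator_bound[lT [l l0 hT]].
  by apply: bounded_by_operator (bounded_by_comp k0 hS hT) => c x y /=; rewrite lT lS.
Qed.

Definition generated_algebra A T := forall N, closed_algebra N -> N A -> N T.

Lemma generated_algebra_closed A : bounded_operator A -> closed_algebra (generated_algebra A).
Proof.
move=> bA; split.
- by move=> T; apply; [exact: bounded_closed_algebra|].
- by move=> N cN NA; exact: ca_id.
- by move=> a S T gS gT N cN NA; apply: (ca_lin cN); [exact: gS|exact: gT].
- by move=> S T gS gT N cN NA; apply: (ca_comp cN); [exact: gS|exact: gT].
- move=> L bL hL N cN NA; apply: (ca_cl cN) => // e /hL[S gS ?]; exists S => //.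
  exact: gS.
Qed.

Definition commutant B : set (H -> H) :=
  [set T | bounded_operator T /\ forall h, T (B h) = B (T h)].

Lemma commutant_closed_algebra B : bounded_operator B -> closed_algebra (commutant B).
Proof.
move=> bB; have [lB [k k0 hB]] := bounded_operator_bound bB; have cb := bounded_closed_algebra.
split.
- by move=> T [].
- by split=> //; exact: ca_id.
- move=> a S T [bS cS] [bT cT]; split; first exact: (ca_lin cb).
  move=> h; change (a *: S (B h) + T (B h) = B (a *: S h + T h)).
  by rewrite cS cT lB.
- by move=> S T [bS cS] [bT cT]; split=> [|h /=]; [exact: (ca_comp cb)|rewrite cT cS].
- move=> L bL hL; split=> // h; apply/eqP; rewrite -subr_eq0; apply/eqP/rnorm_eq0.
  apply: (@eq0_of_eps _ _ (rnorm (B h) + k * rnorm h)).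
  + by rewrite addr_ge0 ?mulr_ge0 ?rnorm_ge0.
  + exact: rnorm_ge0.
  move=> e /hL[S [_ cS] hS].
  have -> : L (B h) - B (L h) = (L - S) (B h) - B ((L - S) h).
    change (L (B h) - B (L h) = L (B h) - S (B h) - B (L h - S h)).
    by rewrite (linB lB) cS opprB addrA subrK.
  apply: le_trans (rnormB _ _) _; rewrite mulrDr lerD//.
  by apply: le_trans (hB _) _; rewrite mulrCA ler_wpM2l.
Qed.

Lemma selfadj_norm_closed : norm_closed [set T | selfadj T].
Proof.
move=> L bL hL x y; apply/eqP; rewrite -subr_eq0 -normr_eq0; apply/eqP.
apply: (@eq0_of_eps _ _ (rnorm x * rnorm y + rnorm x * rnorm y)).
- by rewrite addr_ge0 ?mulr_ge0 ?rnorm_ge0.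
- exact: normr_ge0.
move=> e /hL[S sS hS].
have -> : rdot (L x) y - rdot x (L y) = rdot ((L - S) x) y - rdot x ((L - S) y).
  by rewrite rdotBl rdotBr (sS x y); lra.
apply: le_trans (ler_normB _ _) _; rewrite mulrDr lerD//.
  by apply: le_trans (CS hdot _ _) _; rewrite mulrA ler_wpM2r ?rnorm_ge0.
by apply: le_trans (CS hdot _ _) _; rewrite mulrCA ler_wpM2l ?rnorm_ge0.
Qed.

Lemma selfadj_inverse S T : selfadj S -> (forall h, S (T h) = h) -> selfadj T.
Proof. by move=> sS ST x y; rewrite -{1}(ST y) -sS ST. Qed.

Lemma bounded_by_of_sqr T q : 0 <= q ->
  (forall h, rdot (T h) (T h) <= q ^+ 2 * rdot h h) -> bounded_by T q.
Proof.
move=> q0 hT h; rewrite -ler_sqr ?nnegrE ?mulr_ge0 ?rnorm_ge0// exprMn.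
by rewrite !(rnorm_sqr hdot).
Qed.

Lemma nonneg_bounded_by T q : linear T -> selfadj T -> nonneg T -> 0 <= q ->
  (forall h, rdot (T h) h <= q * rdot h h) -> bounded_by T q.
Proof.
move=> lT sT pT q0 hT; apply: bounded_by_of_sqr => // h.
apply: le_trans (nonneg_sqr_le hdot lT sT pT hT h) _.
by rewrite expr2 -mulrA ler_wpM2l.
Qed.

(** For [c] larger than a bound of [K] plus [d], the operator [X = 1 - K/c]
    satisfies [0 <= X <= 1 - d/c], and [K = c (1 - X)]. *)
Lemma inverse_of_below N K (d : R) : closed_algebra N -> N K -> selfadj K -> 0 < d ->
  (forall h, d * rdot h h <= rdot (K h) h) ->
  exists2 S, N S & S \o K = idfun /\ K \o S = idfun.
Proof.
move=> cN NK sK d0 hK.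
have [lK [k k0 bK]] := bounded_operator_bound (ca_bd cN NK).
pose c := k + d; have c0 : 0 < c by rewrite /c; lra.
pose X := idfun - (c^-1)%:C%C *: K.
have XE h : X h = h - c^-1 *r K h by [].
have NX : N X by apply: (ca_B cN (ca_id cN)); exact: (ca_Z cN).
have lX := ca_linear cN NX.
have ci : c^-1 * c = 1 by rewrite mulVf// lt0r_neq0.
have ci0 : 0 < c^-1 by rewrite invr_gt0.
have q01 : 0 <= 1 - d / c < 1.
  apply/andP; split; last by have := mulr_gt0 d0 ci0; lra.
  rewrite subr_ge0 ler_pdivrMr// mul1r /c; lra.
have bX : bounded_by X (1 - d / c).
  apply: nonneg_bounded_by => //; last 2 first.
  - by case/andP: q01.
  - move=> h; rewrite XE rdotBl rdotZl; have := hK h; have := ler_wpM2l (ltW ci0) (hK h).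
    by move: (rdot (K h) h) (rdot h h) => u v; rewrite mulrBl mul1r (mulrC d) mulrA; lra.
  - by move=> x y; rewrite !XE rdotBl rdotBr rdotZl rdotZr sK.
  move=> h; rewrite XE rdotBl rdotZl subr_ge0 mulrC ler_pdivrMr//.
  have := bounded_by_rdot hdot bK h; have := ler_norm (rdot (K h) h); have := rdot_ge0 hdot h.
  rewrite /c; nra.
have [S NS [SX XS]] := one_sub_inverse cN NX q01 bX.
have lS := ca_linear cN NS.
have e h : (idfun - X) h = c^-1 *r K h.
  by change (h - X h = c^-1 *r K h); rewrite XE subKr.
exists ((c^-1)%:C%C *: S); first exact: (ca_Z cN).
split; apply/funext => h.
  change (c^-1 *r S (K h) = h).
  by rewrite -(linZ lS) -e; apply: (congr1 (@^~ h) SX).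
change (K (c^-1 *r S h) = h).
by rewrite (linZ lK) -e; apply: (congr1 (@^~ h) XS).
Qed.

(** With [C = 1 - Y] the equation [C^2 = 1 - X] becomes [Y = (X + Y^2) / 2], whose
    right-hand side maps the ball of radius [q] into itself and contracts it by
    the factor [q]. *)
Lemma sqrt_one_sub N X (q : R) : closed_algebra N -> N X -> selfadj X -> 0 <= q < 1 -> bounded_by X q ->
  exists C D, [/\ N C, N D, selfadj C, nonneg C &
    [/\ forall h, C (C h) = h - X h, forall h, C (D h) = h & forall h, D (C h) = h]].
Proof.
move=> cN NX sX q01 bX; have /andP[q0 q1] := q01.
have two : (2^-1 : R) * 2 = 1 by rewrite mulVf.
have lX := ca_linear cN NX.
pose Phi Y : H -> H := (2^-1)%:C%C *: (X + (Y \o Y)).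
have PhiE Y h : Phi Y h = 2^-1 *r (X h + Y (Y h)) by [].
have [|||||Y [[NY sY] bY fY]] :=
  @contraction_fixpoint _ _ (N `&` [set T | selfadj T]) Phi q q q01 q0.
- split; first exact: (ca_0 cN).
  by move=> x y; rewrite rdot0l rdot0r.
- move=> L bL hL; split.
    by apply: (ca_cl cN) => // e /hL[S [NS _] hS]; exists S.
  by apply: selfadj_norm_closed => // e /hL[S [_ NS] hS]; exists S.
- by move=> T [/(ca_bd cN)].
- move=> T [NT sT] bT; split.
    split; first by apply: (ca_Z cN); apply: (ca_D cN) => //; exact: (ca_comp cN).
    by move=> x y; rewrite !PhiE rdotZl rdotZr rdotDl rdotDr sX !sT.
  move=> h; rewrite PhiE rnormZ ger0_norm ?invr_ge0//.
  have := rnormD (X h) (T (T h)); have := bX h; have := bT (T h); have := bT h.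
  have := rnorm_ge0 h; have := rnorm_ge0 (T h).
  move: (rnorm (X h + _)) (rnorm (X h)) (rnorm (T (T h))) (rnorm (T h)) (rnorm h) => a b c d e.
  move=> d0 e0 h1 h2 h3 h4.
  have : q * d <= q * (q * e) by rewrite ler_wpM2l.
  have : q * (q * e) <= q * e by rewrite ler_wpM2l// ler_piMl//; lra.
  nra.
- move=> S T k [NS _] [NT _] bS bT k0 hST h.
  have lS := ca_linear cN NS.
  have -> : (Phi S - Phi T) h = 2^-1 *r (S ((S - T) h) + (S - T) (T h)).
    change (Phi S h - Phi T h = 2^-1 *r (S (S h - T h) + (S (T h) - T (T h)))).
    rewrite !PhiE -scalerBr (linB lS) addrA subrK; congr (_ *: _).
    by rewrite opprD addrACA subrr add0r.
  rewrite rnormZ ger0_norm ?invr_ge0//.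
  have := rnormD (S ((S - T) h)) ((S - T) (T h)).
  have := bS ((S - T) h); have := hST h; have := hST (T h); have := bT h.
  have := rnorm_ge0 h; have := rnorm_ge0 (T h).
  move: (rnorm (S _ + _)) (rnorm (S _)) (rnorm ((S - T) (T h))) (rnorm ((S - T) h)) (rnorm (T h)) (rnorm h).
  move=> a b c d e f e0 f0 h1 h2 h3 h4 h5.
  have : q * d <= q * (k * f) by rewrite ler_wpM2l.
  have : k * e <= k * (q * f) by rewrite ler_wpM2l.
  nra.
have lY := ca_linear cN NY.
have YE h z : rdot (Y (Y h)) z = 2 * rdot (Y h) z - rdot (X h) z.
  have := congr1 (fun f => rdot (f h) z) fY; rewrite /= PhiE rdotZl rdotDl => <-.
  by rewrite mulrA mulfV// mul1r; lra.
have [D ND [DC CD]] := one_sub_inverse cN NY q01 bY.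
exists (idfun - Y), D; split=> //.
- exact: (ca_B cN (ca_id cN)).
- by move=> x y; change (rdot (x - Y x) y = rdot x (y - Y y)); rewrite rdotBl rdotBr sY.
- move=> h; change (0 <= rdot (h - Y h) h); rewrite rdotBl subr_ge0.
  have := bounded_by_rdot hdot bY h; have := ler_norm (rdot (Y h) h); have := rdot_ge0 hdot h.
  nra.
split=> h; [|exact: (congr1 (@^~ h) CD)|exact: (congr1 (@^~ h) DC)].
change ((h - Y h) - Y (h - Y h) = h - X h).
by apply: rdot_ext => z; rewrite (linB lY) !rdotBl YE; lra.
Qed.

(** * The structure of a well-supported positive operator *)

Section Gap.
Variables (A : H -> H) (al : R).
Hypotheses (pA : positive_operator dot A) (al0 : 0 < al)
  (gap : forall h, al * rdot (A h) h <= rdot (A h) (A h)).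

(** Cauchy-Schwarz for the form [<A ., .>] at [v] and [A v], combined with [gap]
    at [v]. *)
Lemma range_below v : al * rdot (A v) (A v) <= rdot (A (A v)) (A v).
Proof.
have [lA _] := pA.1; have sA := positive_selfadj pA; have qA := positive_nonneg pA.
have := nonneg_CS lA sA qA v (A v); have := gap v; have := qA v; have := qA (A v).
move: (rdot (A v) v) (rdot (A (A v)) (A v)) (rdot_ge0 hdot (A v)) => x y.
move: (rdot (A v) (A v)) => w w0 y0 x0 gw cs.
have [->|wn0] := eqVneq w 0; first by rewrite mulr0.
have wp : 0 < w by rewrite lt0r wn0.
rewrite -(ler_pM2r wp).
have : al * (x * y) <= w * y by rewrite mulrA ler_wpM2r.
have : al * w ^+ 2 <= al * (x * y) by rewrite ler_wpM2l// ltW.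
nra.
Qed.

(** The projection [E] onto the kernel of [A] is the norm limit of the powers of
    [U = 1 - A/c], because [U] contracts the range of [A] and fixes its kernel.
    The operator [A + c E] is invertible, and [C] is its square root. *)
Lemma gap_structure : exists E C D,
  [/\ generated_algebra A E, generated_algebra A C, generated_algebra A D,
      [/\ selfadj E, selfadj C, nonneg C & selfadj D] &
   [/\ forall h, E (E h) = E h, forall h, A (E h) = 0,
       forall h, C (D h) = h, forall h, D (C h) = h &
       forall h, A h = C (C (h - E h))]].
Proof.
have al_gt0 := al0; have bA := pA.1; have sA := positive_selfadj pA; have qA := positive_nonneg pA.
have [lA [k k0 bk]] := bounded_operator_bound bA.
have cg := generated_algebra_closed bA; have gA : generated_algebra A A by move=> N cN.
pose c := k + al; have c0 : 0 < c by rewrite /c ltr_wpDl.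
have ci0 : 0 < c^-1 by rewrite invr_gt0.
have cci : c * c^-1 = 1 by rewrite mulfV// lt0r_neq0.
pose U := idfun - (c^-1)%:C%C *: A.
have UE h : U h = h - c^-1 *r A h by [].
have gU : generated_algebra A U by apply: (ca_B cg (ca_id cg)); exact: (ca_Z cg).
have lU := ca_linear cg gU.
have UA h : U (A h) = A (U h) by rewrite !UE (linB lA) (linZ lA).
have AE h : A h = c *r (h - U h).
  by rewrite UE subKr scalerA -rmorphM /= cci scale1r.
(* [|U w|^2 <= |w|^2 - <A w, w> / c <= (1 - al / c) |w|^2] for [w] in the range *)
pose q := Num.sqrt (1 - al / c).
have qq : q ^+ 2 = 1 - al / c.
  by rewrite sqr_sqrtr// subr_ge0 ler_pdivrMr// mul1r /c; lra.
have q0 : 0 <= q := sqrtr_ge0 _.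
have q1 : q < 1.
  rewrite -(@ltr_sqr _ q 1) ?nnegrE// qq expr1n; have := mulr_gt0 al0 ci0; lra.
have q01 : 0 <= q < 1 by rewrite q0 q1.
have UAq v : rnorm (U (A v)) <= q * rnorm (A v).
  rewrite -ler_sqr ?nnegrE ?mulr_ge0 ?rnorm_ge0// exprMn !(rnorm_sqr hdot) qq.
  have b1 := range_below v.
  have b2 : rdot (A (A v)) (A (A v)) <= c * rdot (A (A v)) (A v).
    apply: (nonneg_sqr_le hdot lA sA qA) => h.
    have := bounded_by_rdot hdot bk h; have := ler_norm (rdot (A h) h); have := rdot_ge0 hdot h.
    by rewrite /c; nra.
  rewrite UE !(rdotBl, rdotBr) !(rdotZl, rdotZr) [rdot (A v) (A (A v))]rdotC.
  move: (rdot (A (A v)) (A (A v))) (rdot (A (A v)) (A v)) (rdot (A v) (A v)) b1 b2.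
  move=> x y z b1 b2.
  have : c^-1 * (c^-1 * x) <= c^-1 * y.
    rewrite ler_wpM2l ?(ltW ci0)//; have := ler_wpM2l (ltW ci0) b2.
    by rewrite mulrA [_ * c]mulrC cci mul1r.
  have := ler_wpM2l (ltW ci0) b1.
  rewrite mulrBl mul1r (mulrC al) mulrA; lra.
pose En n : H -> H := iter n U.
have gEn n : generated_algebra A (En n).
  elim: n => [|n IH]; first exact: (ca_id cg).
  by have := ca_comp cg gU IH.
have lEn n := ca_linear cg (gEn n).
have EnA n h : En n (A h) = A (En n h).
  by elim: n => //= n IH; rewrite IH UA.
have EnAq n v : rnorm (En n (A v)) <= q ^+ n * rnorm (A v).
  elim: n => [|n IH] /=; first by rewrite expr0 mul1r.
  rewrite EnA; apply: le_trans (UAq _) _; rewrite -EnA exprS -mulrA.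
  exact: ler_wpM2l.
have [] := @geometric_limit _ _ En (c^-1 * k) q q01 _ lEn.
  by rewrite mulr_ge0// ltW.
  move=> n h; have -> : (En n.+1 - En n) h = - (c^-1 *r (En n (A h))).
    by change (U (En n h) - En n h = - (c^-1 *r (En n (A h)))); rewrite EnA UE addrAC subrr sub0r.
  rewrite rnormN rnormZ ger0_norm ?(ltW ci0)// -!mulrA ler_wpM2l ?(ltW ci0)//.
  by apply: le_trans (EnAq _ _) _; rewrite mulrCA ler_wpM2l ?exprn_ge0.
move=> E lE hE.
have bE : bounded_operator E.
  have [n /(_ n (leqnn n)) hn] := hE 1 ltr01.
  have [_ [l _ hl]] := bounded_operator_bound (ca_bd cg (gEn n)).
  exact: bounded_by_operator lE (bounded_by_near hl hn).
have gE : generated_algebra A E.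
  apply: (ca_cl cg) => // e e0; have [n /(_ n (leqnn n)) hn] := hE e e0.
  by exists (En n).
have AcA : commutant A A by [].
have EA h : E (A h) = A (E h).
  by have [_ ->] := gE _ (commutant_closed_algebra bA) AcA.
have AE0 h : A (E h) = 0.
  apply: rnorm_eq0; rewrite -EA; apply: (@eq0_of_eps _ _ (rnorm (A h) + 1)).
  - by rewrite addr_ge0 ?rnorm_ge0.
  - exact: rnorm_ge0.
  move=> e e0; have [n hn] := hE e e0.
  have [m hm] := geometric_small q01 e0 (rnorm_ge0 (A h)).
  have := hn _ (leq_maxl n m) (A h); have := hm _ (leq_maxr n m).
  have := EnAq (maxn n m) h; set p := maxn n m => h1 h2 h3.
  have := rnormD ((E - En p) (A h)) (En p (A h)); rewrite /= subrK; lra.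
have sU : selfadj U.
  by move=> x y; rewrite !UE rdotBl rdotBr rdotZl rdotZr sA.
have sEn n : selfadj (En n).
  elim: n => [|n IH] x y //; rewrite /En iterSr -/(En n _) IH sU.
  by rewrite -/(En n y) -[U (En n y)]/(En n.+1 y) /En iterS.
have sE : selfadj E.
  apply: selfadj_norm_closed => // e e0; have [n /(_ n (leqnn n)) hn] := hE e e0.
  by exists (En n) => //; exact: sEn.
have EE h : E (E h) = E h.
  apply/eqP; rewrite -subr_eq0; apply/eqP/rnorm_eq0.
  apply: (@eq0_of_eps _ _ (rnorm (E h)) (rnorm_ge0 _) (rnorm_ge0 _)) => e e0.
  have [n /(_ n (leqnn n)) hn] := hE e e0.
  have EnE : En n (E h) = E h.
    by elim: (n) => //= m ->; rewrite UE AE0 scaler0 subr0.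
  have -> : E (E h) - E h = (E - En n) (E h); last exact: hn.
  by change (E (E h) - E h = E (E h) - En n (E h)); rewrite EnE.
pose X := U - E.
have XE h : X h = U h - E h by [].
have gX : generated_algebra A X by exact: (ca_B cg).
have sX : selfadj X by move=> x y; rewrite !XE rdotBl rdotBr sU sE.
have UE' h : U (E h) = E h by rewrite UE AE0 scaler0 subr0.
(* [X = U P] with [P] the projection [1 - E] onto the closure of the range of [A] *)
have bX : bounded_by X q.
  have ran n h : exists w, h - En n h = A w.
    elim: n => [|n [w hw]]; first by exists 0; rewrite (lin0 lA) subrr.
    exists (w + c^-1 *r En n h); rewrite (linD lA) -hw (linZ lA).
    by rewrite /= UE opprB addrA addrAC.
  have bU : exists2 l, 0 <= l & bounded_by U l := (bounded_operator_bound (ca_bd cg gU)).2.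
  have [l l0 hl] := bU.
  have step h : rnorm (X h) <= q * rnorm (h - E h).
    apply: (@le_of_eps _ _ _ ((l + q) * rnorm h)).
      by rewrite mulr_ge0 ?rnorm_ge0 ?addr_ge0.
    move=> e e0; have [n /(_ n (leqnn n)) hn] := hE e e0.
    have [w hw] := ran n h.
    have -> : X h = U (A w) - U ((E - En n) h).
      rewrite XE -hw -UE' -!(linB lU) /=; congr U.
      by rewrite opprB addrA subrK.
    apply: le_trans (rnormB _ _) _.
    have := UAq w; have := hl ((E - En n) h); have := hn h.
    have : rnorm (A w) <= rnorm (h - E h) + rnorm ((E - En n) h).
      by rewrite -hw; have := rnormD (h - E h) ((E - En n) h); rewrite /= addrA subrK.
    have := rnorm_ge0 h; have := rnorm_ge0 ((E - En n) h).
    move: (rnorm (U (A w))) (rnorm (U _)) (rnorm (A w)) (rnorm ((E - En n) h)) (rnorm h) (rnorm (h - E h)).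
    move=> a1 a2 a3 a4 a5 a6 h0 h1 h2 h3 h4 h5.
    have : q * a3 <= q * (a6 + a4) by rewrite ler_wpM2l.
    have : (l + q) * a4 <= (l + q) * (e * a5) by rewrite ler_wpM2l// addr_ge0.
    nra.
  move=> h; apply: le_trans (step h) _; rewrite ler_wpM2l//.
  rewrite -ler_sqr ?nnegrE ?rnorm_ge0// !(rnorm_sqr hdot).
  rewrite !(rdotBl, rdotBr) (rdotC _ h (E h)).
  have e : rdot (E h) (E h) = rdot (E h) h by rewrite sE EE -sE.
  have := rdot_ge0 hdot (E h); rewrite e; lra.
have [C0 [D0 [gC0 gD0 sC0 qC0 [CC CD DC]]]] := sqrt_one_sub cg gX sX q01 bX.
have lC0 := ca_linear cg gC0; have lD0 := ca_linear cg gD0.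
(* [C0] is the root of [1 - X = (A + c E) / c] *)
pose s := Num.sqrt c.
have ss : s * s = c by rewrite -expr2 sqr_sqrtr// ltW.
have s0 : 0 < s by rewrite sqrtr_gt0.
have ssi : s * s^-1 = 1 by rewrite mulfV// lt0r_neq0.
pose C := s%:C%C *: C0; pose D := (s^-1)%:C%C *: D0.
have CE h : C h = s *r C0 h by [].
have DE h : D h = s^-1 *r D0 h by [].
have sC : selfadj C by move=> x y; rewrite !CE rdotZl rdotZr sC0.
have CDh h : C (D h) = h.
  by rewrite CE DE (linZ lC0) scalerA -rmorphM /= ssi scale1r CD.
exists E, C, D; split=> //.
- exact: (ca_Z cg).
- exact: (ca_Z cg).
- split=> //; last exact: selfadj_inverse sC CDh.
  by move=> h; rewrite CE rdotZl mulr_ge0// ltW.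
split=> // h.
  by rewrite DE CE (linZ lD0) scalerA -rmorphM /= mulrC ssi scale1r DC.
rewrite !CE (linZ lC0) scalerA -rmorphM /= ss CC XE AE; congr (_ *: _).
by apply: rdot_ext => z; rewrite (linB lU) (linB lE) UE' EE !rdotBl; lra.
Qed.

End Gap.
End Structure.

(** * Uniqueness of the square root, and the spectral gap *)

Section RootAndGap.
Context {R : realType} {H : completeNormedModType R[i]}.
Variables (dot : {dot H for Num.conj}) (hdot : hilbert_dot dot).
Implicit Types (x y h : H) (S T L A B : H -> H).
Local Notation rdot := (rdot dot).
Local Notation selfadj := (selfadj dot).
Local Notation nonneg := (nonneg dot).

(** [T] commutes with [A], so that [A], and with it [S], lies in the commutant of
    [T]. *)
Lemma generated_algebra_comm A S T : bounded_operator A -> generated_algebra A S -> generated_algebra A T ->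
  forall h, S (T h) = T (S h).
Proof.
move=> bA gS gT.
have [_ //] : commutant T S.
have bT : bounded_operator T by apply: gT; [exact: bounded_closed_algebra|].
apply: gS; first exact: commutant_closed_algebra.
have [_ cT] : commutant A T by apply: gT; [exact: commutant_closed_algebra|].
by split.
Qed.

Lemma nonneg_eq0 T h : linear T -> selfadj T -> nonneg T -> rdot (T h) h = 0 -> T h = 0.
Proof.
move=> lT sT pT e; apply: (rdot_ext hdot) => z; rewrite rdot0l.
have := nonneg_CS lT sT pT h z; rewrite e mul0r => le0.
by apply/eqP; rewrite -sqrf_eq0 eq_le le0 sqr_ge0.
Qed.

(** Another positive root [B1] commutes with [A], hence with [B]; then
    [(B1 + B)(B1 - B) = 0] and both terms of the sum being positive,
    [B1 - B] is killed by [B1] and by [B], so that its square is zero. *)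
Lemma op_sqrt_eq A B : generated_algebra A B -> positive_operator dot B -> B \o B = A ->
  op_sqrt dot A = B.
Proof.
move=> gB pB BB; rewrite /op_sqrt.
have [pB1 BB1] : [set B | positive_operator dot B /\ B \o B = A] (xget 0 [set B | positive_operator dot B /\ B \o B = A]).
  by apply: xgetPex; exists B.
move: (xget _ _) pB1 BB1 => B1 pB1 BB1.
have cB h : B (B1 h) = B1 (B h).
  have [_ //] : commutant B1 B; apply: gB; first exact: commutant_closed_algebra pB1.1.
  rewrite -BB1; split; first exact: (ca_comp (@bounded_closed_algebra _ _)) pB1.1 pB1.1.
  by [].
have [l0 _] := pB.1; have [l1 _] := pB1.1.
have s0 := positive_selfadj pB; have s1 := positive_selfadj pB1.
have q0 := positive_nonneg pB; have q1 := positive_nonneg pB1.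
have sq h : B1 (B1 h) = B (B h).
  by have := congr1 (@^~ h) BB1; rewrite -BB.
apply/funext => h; set k := B1 h - B h.
have k0 : rdot (B1 k + B k) k = 0.
  by rewrite /k (linB l1) (linB l0) cB sq addrA subrK subrr rdot0l.
have k1 : B1 k = 0.
  by apply: nonneg_eq0 => //; move: k0 (q0 k) (q1 k); rewrite rdotDl; lra.
have k2 : B k = 0.
  by apply: nonneg_eq0 => //; move: k0 (q0 k) (q1 k); rewrite rdotDl; lra.
apply/eqP; rewrite -subr_eq0 -/k; apply/eqP/rnorm_eq0/eqP; rewrite -sqrf_eq0 (rnorm_sqr hdot).
by rewrite {1}/k rdotBl s1 s0 k1 k2 subrr.
Qed.

(** With [t = al/2], the claim is [(A - t)^2 >= t^2]. Let [m] be the largest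
    number such that [(A - t)^2 >= m], and suppose [m < t^2]. With [r] the square
    root of [m], the operator [(A - t)^2 - m] is the product of [A - (t + r)] and
    [A - (t - r)], both invertible. A positive operator with a bounded inverse is
    bounded below, which contradicts the choice of [m]. *)
Lemma gap_of_resolvent A (al : R) : positive_operator dot A -> 0 < al ->
  (forall u, 0 < u < al -> exists2 S, bounded_operator S & forall h, S (A h - u *r h) = h) ->
  forall h, al * rdot (A h) h <= rdot (A h) (A h).
Proof.
move=> pA al0 inv.
have [Hz|] := pselect (forall h : H, h = 0).
  by move=> h; rewrite (Hz (A h)) !rdot0l mulr0.
move/existsNP => [h0 h00].
have bA := pA.1; have sA := positive_selfadj pA; have [lA _] := bA.
have cb := @bounded_closed_algebra R H.
pose t := al / 2.
pose G : H -> H := A - (t%:C%C) *: idfun.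
have GE h : G h = A h - t *r h by [].
have bG : bounded_operator G.
  by apply: (ca_B cb bA); apply: (ca_Z cb); exact: ca_id.
have [lG _] := bG.
have sG : selfadj G by move=> x y; rewrite !GE rdotBl rdotBr rdotZl rdotZr sA.
pose W := [set s : R | forall h, s * rdot h h <= rdot (G h) (G h)].
have W0 : W 0 by move=> h; rewrite mul0r rdot_ge0.
have n0 : 0 < rdot h0 h0 by rewrite -(rnorm_sqr hdot) exprn_gt0// rnorm_gt0.
(* a nonzero vector bounds [W] above *)
have supW : has_sup W.
  split; first by exists 0.
  by exists (rdot (G h0) (G h0) / rdot h0 h0) => s /(_ h0); rewrite ler_pdivlMr.
pose m := sup W.
have m0 : 0 <= m by exact: sup_upper_bound.
have Wm : W m.
  move=> h; have [->|hn0] := pselect (h = 0); first by rewrite rdot0l mulr0 rdot_ge0.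
  have hp : 0 < rdot h h by rewrite -(rnorm_sqr hdot) exprn_gt0// rnorm_gt0.
  rewrite -ler_pdivlMr//; apply: ge_sup => [|s Ws]; first by exists 0.
  by rewrite ler_pdivlMr.
suff tm : t ^+ 2 <= m.
  move=> h; have : t ^+ 2 * rdot h h <= rdot (G h) (G h).
    by apply: le_trans (Wm h); rewrite ler_wpM2r// rdot_ge0.
  rewrite !GE !(rdotBl, rdotBr) !(rdotZl, rdotZr) [rdot h (A h)]rdotC.
  have -> : al = t + t by rewrite /t -splitr.
  lra.
rewrite leNgt; apply/negP => mt.
pose r := Num.sqrt m.
have r0 : 0 <= r := sqrtr_ge0 _.
have rr : r * r = m by rewrite -expr2 sqr_sqrtr.
have t0 : 0 < t by rewrite /t; lra.
have rt : r < t by rewrite -ltr_sqr ?nnegrE ?(ltW t0)// expr2 rr.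
have [|S1 bS1 iS1] := inv (t + r); first by rewrite /t in rt *; lra.
have [|S2 bS2 iS2] := inv (t - r); first by rewrite /t in rt *; lra.
pose K : H -> H := (G \o G) - m%:C%C *: idfun.
have KE h : K h = G (G h) - m *r h by [].
have bK : bounded_operator K.
  by apply: (ca_B cb); [exact: (ca_comp cb)|apply: (ca_Z cb); exact: ca_id].
have sK : selfadj K by move=> x y; rewrite !KE rdotBl rdotBr rdotZl rdotZr !sG.
have qK : nonneg K by move=> h; rewrite KE rdotBl rdotZl sG subr_ge0.
have SK h : S2 (S1 (K h)) = h.
  rewrite -[RHS]iS2; congr S2; rewrite -[RHS]iS1; congr S1.
  apply: (rdot_ext hdot) => z.
  rewrite KE !GE !(linB lA) !(linZ lA) !scalerBr !scalerA -!rmorphM /=.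
  rewrite !(rdotBl, rdotZl) -rr; ring.
have [lS [l l0 bS]] := bounded_operator_bound (ca_comp cb bS2 bS1).
have [lK [k k0 bk]] := bounded_operator_bound bK.
have low h : rdot h h <= l ^+ 2 * (k * rdot (K h) h).
  have : rnorm h <= l * rnorm (K h) by have := bS (K h); rewrite /= SK.
  rewrite -ler_sqr ?nnegrE ?mulr_ge0 ?rnorm_ge0// exprMn !(rnorm_sqr hdot) => /le_trans; apply.
  rewrite ler_wpM2l ?sqr_ge0//; apply: (nonneg_sqr_le hdot lK sK qK) => h'.
  by have := bounded_by_rdot hdot bk h'; apply: le_trans; exact: ler_norm.
(* the [1] only guards against a vanishing bound *)
pose d := (l ^+ 2 * k + 1)^-1.
have c0 : 0 < l ^+ 2 * k + 1 by have := mulr_ge0 (sqr_ge0 l) k0; lra.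
have : m + d <= m.
  apply: sup_upper_bound => // h.
  have : d * rdot h h <= rdot (K h) h.
    rewrite mulrC ler_pdivrMr//; have := low h; have := qK h; lra.
  rewrite KE rdotBl rdotZl sG; lra.
have : 0 < d by rewrite invr_gt0.
lra.
Qed.

Lemma gap_of_well_supported M A : closed_algebra M -> M A -> positive_operator dot A ->
  well_supported M A -> exists2 al : R, 0 < al &
    forall h, al * rdot (A h) h <= rdot (A h) (A h).
Proof.
move=> cM MA pA wA.
have : nbhs (0 : R[i]^o) (~` (spectrum M A `\ 0 : set R[i]^o)).
  apply: open_nbhs_nbhs; split; first exact: closed_openC.
  by move=> [_]; apply.
move=> /nbhs_ballP[e /= e0 he].
have Ree : 0 < Re e by move: e0; rewrite ltcE => /andP[].
exists (Re e) => //; apply: gap_of_resolvent => // u /andP[u0 ue].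
have : (~` (spectrum M A `\ 0)) (u%:C)%C.
  apply: he; rewrite -ball_normE /= sub0r normrN normc_def /= expr0n addr0 sqrtr_sqr.
  rewrite ltcE /= gtr0_norm// ue andbT; apply/eqP/ger0_Im; exact: ltW.
have un0 : (u%:C)%C <> 0 :> R[i] by move=> [] /eqP; rewrite gt_eqF.
move=> nsp; have [S MS [_ SA]] : exists2 S, M S &
    ((u%:C)%C *: (idfun : H -> H) - A) \o S = idfun /\
    S \o ((u%:C)%C *: (idfun : H -> H) - A) = idfun.
  by apply: contrapT => h; apply: nsp; split.
have lS := ca_linear cM MS.
exists (- S).
  by rewrite -[- S]scaleN1r; apply: (ca_Z (@bounded_closed_algebra _ _)); exact: (ca_bd cM).
move=> h; change (- S (A h - u *r h) = h).
by rewrite -(linN lS) opprB; exact: (congr1 (@^~ h) SA).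
Qed.

End RootAndGap.

(** * Extreme points of compact sets of functionals *)

Section Faces.
Context {R : realType} {X : eqType}.
Local Notation fspace := ({ptws X -> R}).
Implicit Types (f g : fspace) (F K : set fspace).

Lemma eval_continuous (x : X) : continuous (fun f : fspace => f x).
Proof. exact: (@proj_continuous X (fun=> R : topologicalType) x). Qed.

Lemma closed_eval_le (x : X) (c : R) : closed [set f : fspace | f x <= c].
Proof.
by apply: (@preimage_closed _ _ (fun f : fspace => f x) _ _ (@closed_le R c)) => f _;
  exact: eval_continuous.
Qed.

Lemma closed_eval_ge (x : X) (c : R) : closed [set f : fspace | c <= f x].
Proof.
by apply: (@preimage_closed _ _ (fun f : fspace => f x) _ _ (@closed_ge R c)) => f _;
  exact: eval_continuous.
Qed.

Lemma closed_eq0 (F : fspace -> R) : continuous F -> closed [set f | F f = 0].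
Proof.
by move=> cF; apply: (@preimage_closed _ _ F _ _ (@closed_eq R 0)) => f _; exact: cF.
Qed.

Lemma closed_linear_relation (a : R) (x y z : X) :
  closed [set f : fspace | f x - (a * f y + f z) = 0].
Proof.
have ev := eval_continuous.
apply: (@closed_eq0 (fun f => f x - (a * f y + f z))) => f.
apply: (@continuousB R R fspace (fun f => f x) (fun f => a * f y + f z)); first exact: ev.
apply: (@continuousD R R fspace (fun f => a * f y) (fun f => f z)); last exact: ev.
by apply: (@continuousM R fspace (cst a) (fun f => f y)); [exact: cst_continuous|exact: ev].
Qed.

Lemma closed_eval_eq (x : X) (c : R) : closed [set f : fspace | f x = c].
Proof.
by apply: (@preimage_closed _ _ (fun f : fspace => f x) _ _ (@closed_eq R c)) => f _;
  exact: eval_continuous.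
Qed.

Definition mix (t : R) f g : fspace := fun x => t * f x + (1 - t) * g x.

Definition face K F := [/\ closed F, F !=set0, F `<=` K &
  forall g h t, K g -> K h -> 0 < t < 1 -> F (mix t g h) -> F g /\ F h].

(** If a proper average of [g x] and [h x] is the smallest value of [f x] over [F],
    both are. *)
Lemma face_argmin K F x : compact K -> face K F ->
  face K [set f | F f /\ forall g, F g -> f x <= g x].
Proof.
move=> cK [clF [f0 Ff0] FK mF].
have cF : compact F by exact: subclosed_compact clF cK FK.
split.
- have -> : [set f | F f /\ forall g, F g -> f x <= g x] =
      F `&` \bigcap_(g in F) [set f : fspace | f x <= g x].
    by apply/seteqP; split=> f [].
  apply: closedI => //; apply: closed_bigI => g _.
  exact: closed_eval_le.
- have [f /set_mem Ff fmin] : exists2 c, c \in F & forall t, t \in F -> c x <= t x.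
    apply: (@compact_EVT_min fspace R (fun f => f x)) => //; first by exists f0.
    by apply: continuous_subspaceT; exact: eval_continuous.
  by exists f; split=> // g Fg; apply: fmin; exact: mem_set.
- by move=> f [/FK].
move=> g h t Kg Kh t01 [Fm mm]; have [Fg Fh] := mF _ _ _ Kg Kh t01 Fm.
have := mm g Fg; have := mm h Fh; rewrite /mix => m1 m2; case/andP: t01 => t0 t1.
have e : g x = h x.
  apply/eqP; rewrite eq_le; apply/andP; split.
    have : 0 <= t * (h x - g x) by nra.
    by rewrite pmulr_rge0// subr_ge0.
  have : 0 <= (1 - t) * (g x - h x) by nra.
  by rewrite pmulr_rge0 ?subr_gt0// subr_ge0.
have e' : t * g x + (1 - t) * h x = g x by rewrite e; ring.
by split; split=> // k Fk; have := mm k Fk; rewrite /mix e' ?e.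
Qed.

(** Zorn's lemma on the sets removed from [F0]; a decreasing chain of nonempty
    closed subsets of a compact set has a nonempty intersection. *)
Lemma minimal_face K F0 : compact K -> face K F0 ->
  exists F, [/\ face K F, F `<=` F0 & forall G, face K G -> G `<=` F -> F `<=` G].
Proof.
move=> cK fF0.
(* [U = set0] has to qualify, for the empty chain *)
have [|U [fU maxU]] := @Zorn_bigcup fspace [set U | face K (F0 `\` U)].
  move=> Fam FamP tot.
  have [[U0 FU0]|noFam] := pselect (exists U, Fam U); last first.
    rewrite /= (_ : \bigcup_(U in Fam) U = set0) ?setD0//.
    by apply/seteqP; split=> // x [U FU]; case: noFam; exists U.
  have DE : F0 `\` \bigcup_(U in Fam) U = \bigcap_(U in Fam) (F0 `\` U).
    apply/seteqP; split=> f.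
      by move=> [F0f nU] U FU; split=> // Uf; apply: nU; exists U.
    by move=> h; split; [have [] := h _ FU0|move=> [U FU Uf]; have [] := h _ FU].
  have [clF0 _ F0K _] := fF0.
  have cF0 : compact F0 by exact: subclosed_compact clF0 cK F0K.
  rewrite /= DE; split.
  - by apply: closed_bigI => U /FamP [].
  - pose Phi := filter_from Fam (fun U => F0 `\` U).
    have PF : ProperFilter Phi.
      apply: filter_from_proper; last by move=> U /FamP[].
      apply: filter_from_filter; first by exists U0.
      move=> U V FU FV; have [UV|VU] := tot _ _ FU FV.
        by exists V => // f [F0f nVf]; split; split=> // /UV.
      by exists U => // f [F0f nUf]; split; split=> // /VU.
    have PF0 : Phi F0 by exists U0 => // f [].
    have [f [F0f clf]] := cF0 _ PF PF0.
    exists f => U FU; have [clU _ _ _] := FamP _ FU.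
    by apply: clU => B nB; apply: clf nB; exists U.
  - by move=> f /(_ _ FU0)[/F0K].
  - move=> g h t Kg Kh t01 hm.
    have fm U : Fam U -> (F0 `\` U) g /\ (F0 `\` U) h.
      by move=> FU; have [_ _ _ mU] := FamP _ FU; apply: (mU g h t) => //; exact: hm.
    by split=> U /fm[].
exists (F0 `\` U); split=> //.
move=> G fG GF; apply: contrapT => nFG.
apply: (maxU (~` G)).
  split; first by move=> f Uf /GF [].
  move=> h; apply: nFG => f [F0f nUf]; apply: contrapT => nGf; exact/nUf/h.
rewrite /= setDE setCK (_ : F0 `&` G = G)//.
by apply/seteqP; split=> [f []//|f Gf]; split=> //; have [] := GF f Gf.
Qed.

(** The core of the Krein-Milman theorem: by [face_argmin] every evaluation is
    constant on a minimal face, which is therefore a single point. *)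
Lemma extreme_point_in_face K F0 : compact K -> face K F0 ->
  exists2 f, F0 f & forall g h t, K g -> K h -> 0 < t < 1 -> f = mix t g h ->
    g = f /\ h = f.
Proof.
move=> cK fF0; have [F [fF FF0 minF]] := minimal_face cK fF0.
have [_ [f Ff] FK mF] := fF.
have uniqF g : F g -> g = f.
  move=> Fg; apply/funext => x; apply/eqP; rewrite eq_le.
  have sub := minF _ (face_argmin x cK fF) (fun f h => h.1).
  by have [_ ->//] := sub _ Fg; have [_ ->] := sub _ Ff.
exists f; first exact: FF0.
move=> g h t Kg Kh t01 e.
have [Fg Fh] : F g /\ F h by apply: (mF g h t) => //; rewrite -e.
by split; exact: uniqF.
Qed.

End Faces.

(** * States *)

Section RealStates.
Context {R : realType} {H : completeNormedModType R[i]}.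
Variables (dot : {dot H for Num.conj}) (hdot : hilbert_dot dot).
Variables (M : set (H -> H)) (hM : von_neumann_algebra dot M).
Implicit Types (x y h : H) (S T L A B K : H -> H).
Local Notation rdot := (rdot dot).
Local Notation selfadj := (selfadj dot).
Local Notation pos := (positive_operator dot).
Local Notation I := (idfun : H -> H).
Local Notation fspace := ({ptws (H -> H) -> R}).
Let cM : closed_algebra M := vna_closed_algebra hdot hM.

Lemma adjointC S T : is_adjoint dot S T -> is_adjoint dot T S.
Proof. by move=> aST x y; rewrite dotC -aST -dotC. Qed.

Lemma adjoint_comp_positive S T : bounded_operator S -> bounded_operator T ->
  is_adjoint dot S T -> pos (T \o S).
Proof.
move=> bS bT aST; split; first exact: (ca_comp (@bounded_closed_algebra _ _)).
by move=> h; rewrite /= (adjointC aST) (dot_diag hdot) ler0c sqr_ge0.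
Qed.

(** The real part of a state, extended by [0] outside [M] so that pointwise
    convergence is the weak-* topology. The condition at ['i *: T] says that the
    state takes real values on positive elements. Being real, these functionals
    live in a product of compact real intervals. *)
Definition real_state (f : fspace) : Prop :=
  [/\ forall (a : R) S T, M S -> M T -> f (a%:C%C *: S + T) = a * f S + f T,
      forall T, M T -> pos T -> 0 <= f T /\ f ('i%C *: T) = 0,
      f I = 1 & forall T, ~ M T -> f T = 0].

Section RealStateTheory.
Variables (f : fspace) (sf : real_state f).

Lemma real_stateD S T : M S -> M T -> f (S + T) = f S + f T.
Proof. by case: sf => lf _ _ _ MS MT; have := lf 1 S T MS MT; rewrite scale1r mul1r. Qed.

Lemma real_state0 : f 0 = 0.
Proof. have := real_stateD (ca_0 cM) (ca_0 cM); rewrite addr0; lra. Qed.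

Lemma real_stateZ (a : R) T : M T -> f (a%:C%C *: T) = a * f T.
Proof.
by case: sf => lf _ _ _ MT; have := lf a T 0 MT (ca_0 cM); rewrite real_state0 !addr0.
Qed.

Lemma add_bound_positive T (c : R) : M T -> selfadj T -> bounded_by T c -> pos (c%:C%C *: I + T).
Proof.
move=> MT sT bT; apply: nonneg_positive.
- by apply: (ca_bd cM); apply: (ca_lin cM) => //; exact: ca_id.
- move=> x y; change (rdot (c *r x + T x) y = rdot x (c *r y + T y)).
  by rewrite rdotDl rdotDr rdotZl rdotZr sT.
move=> h; change (0 <= rdot (c *r h + T h) h); rewrite rdotDl rdotZl.
have := bounded_by_rdot hdot bT h; have := ler_norm (- rdot (T h) h); rewrite normrN; lra.
Qed.

(** Both [c + T] and [c - T] are positive. *)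
Lemma real_state_selfadj T (c : R) : M T -> selfadj T -> bounded_by T c ->
  `|f T| <= c /\ f ('i%C *: T) = 0.
Proof.
move=> MT sT bT; case: (sf) => lf pf f1 _; have M1 := ca_id cM.
have [p1 q1] := pf _ (ca_lin cM _ M1 MT) (add_bound_positive MT sT bT).
have MN := ca_Z cM (-1) MT.
have bN : bounded_by (-1 *: T) c.
  by move=> h; rewrite scaleN1r; change (rnorm (- T h) <= c * rnorm h); rewrite rnormN.
have sN : selfadj (-1 *: T).
  by move=> x y; rewrite scaleN1r; change (rdot (- T x) y = rdot x (- T y));
     rewrite rdotNl rdotNr sT.
have [p2 _] := pf _ (ca_lin cM _ M1 MN) (add_bound_positive MN sN bN).
have eN : f (-1 *: T) = - f T.
  by have := real_stateZ (-1) MT; rewrite rmorphN1 mulN1r.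
move: p1 p2; rewrite !lf// eN f1 => p1 p2; split; first by rewrite ler_norml; lra.
have : pos I.
  have bI : bounded_operator I by exact: ca_bd cM _ _.
  by split=> // h; rewrite (dot_diag hdot) ler0c sqr_ge0.
move=> /(pf _ M1)[_ i0].
have Mi := ca_Z cM 'i%C M1; have Mci := ca_Z cM 'i%C (ca_Z cM c%:C%C M1).
have MiT := ca_Z cM 'i%C MT.
move: q1; rewrite scalerDr real_stateD// scalerA mulrC -scalerA real_stateZ// i0.
by rewrite mulr0 add0r.
Qed.

End RealStateTheory.

Lemma cartesian T : M T -> exists X Y, [/\ M X, M Y, selfadj X, selfadj Y & T = X + 'i%C *: Y].
Proof.
move=> MT; have [T' MT' aT] := vna_adj hM MT.
have lT := ca_linear cM MT; have lT' := ca_linear cM MT'.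
have r1 x y : rdot (T x) y = rdot x (T' y) by rewrite !rdotE aT.
have r2 x y : rdot (T' x) y = rdot x (T y) by rewrite rdotC -r1 rdotC.
have ri x y : rdot ('i%C *: x) y = - rdot x ('i%C *: y).
  by rewrite -Im_dot !rdotE linearZl_LR /= cReM /=; lra.
exists (2^-1%:C%C *: (T + T')), (2^-1%:C%C *: (- 'i%C *: (T - T'))).
have M1 : M (T - T') by exact: ca_B.
split.
- by apply: (ca_Z cM); exact: ca_D.
- by do 2 apply: (ca_Z cM).
- move=> x y; change (rdot (2^-1 *r (T x + T' x)) y = rdot x (2^-1 *r (T y + T' y))).
  by rewrite rdotZl rdotZr rdotDl rdotDr r1 r2; lra.
- move=> x y; change (rdot (2^-1 *r (- 'i%C *: (T x - T' x))) y =
    rdot x (2^-1 *r (- 'i%C *: (T y - T' y)))).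
  rewrite rdotZl rdotZr !scaleNr rdotNl rdotNr ri rdotBl r1 r2.
  by rewrite (linZ lT) (linZ lT') scalerBr rdotBr; lra.
apply/funext => h.
change (T h = 2^-1 *r (T h + T' h) + 'i%C *: (2^-1 *r (- 'i%C *: (T h - T' h)))).
have -> : 'i%C *: (2^-1 *r (- 'i%C *: (T h - T' h))) = 2^-1 *r (T h - T' h).
  rewrite 2!scalerA mulrAC mulrN -expr2 sqr_i opprK mul1r //.
by apply: (rdot_ext hdot) => z; rewrite rdotDl !rdotZl rdotBl rdotDl; lra.
Qed.

Lemma real_state_bound T : exists c : R, forall f, real_state f -> `[- c, c]%classic (f T).
Proof.
have [MT|nMT] := pselect (M T); last first.
  by exists 0 => f [_ _ _ /(_ _ nMT) ->]; rewrite /= in_itv /= oppr0 lexx.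
have [X [Y [MX MY sX sY ->]]] := cartesian MT.
have [_ [c _ bX]] := bounded_operator_bound (ca_bd cM MX).
have [_ [d _ bY]] := bounded_operator_bound (ca_bd cM MY).
exists c => f sf.
have [fX _] := real_state_selfadj sf MX sX bX; have [_ fY] := real_state_selfadj sf MY sY bY.
rewrite (real_stateD sf) ?(ca_Z cM)//; last exact: (ca_Z cM).
by rewrite fY addr0 /= in_itv /= -ler_norml.
Qed.

Lemma real_state_closed : closed [set f | real_state f].
Proof.
have -> : [set f : fspace | real_state f] =
  (\bigcap_(p in [set p : R * ((H -> H) * (H -> H)) | M p.2.1 /\ M p.2.2])
     [set f : fspace | f (p.1%:C%C *: p.2.1 + p.2.2) - (p.1 * f p.2.1 + f p.2.2) = 0])
  `&` (\bigcap_(T in [set T | M T /\ pos T]) [set f : fspace | 0 <= f T])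
  `&` (\bigcap_(T in [set T | M T /\ pos T]) [set f : fspace | f ('i%C *: T) = 0])
  `&` [set f : fspace | f I = 1] `&` (\bigcap_(T in ~` M) [set f : fspace | f T = 0]).
  apply/seteqP; split=> f.
    move=> [h1 h2 h3 h4]; do 4?split.
    - by move=> [a [S T]] /= [MS MT]; rewrite h1// subrr.
    - by move=> T [MT pT]; have [] := h2 T MT pT.
    - by move=> T [MT pT]; have [] := h2 T MT pT.
    - exact: h3.
    - by move=> T /h4.
  move=> [[[[h1 h2] h3] h4] h5]; split.
  - by move=> a S T MS MT; apply/eqP; rewrite -subr_eq0; apply/eqP/(h1 (a, (S, T))).
  - by move=> T MT pT; split; [exact: h2|exact: h3].
  - exact: h4.
  - by move=> T nMT; exact: h5.
do 4?apply: closedI.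
- by apply: closed_bigI => p _; exact: closed_linear_relation.
- by apply: closed_bigI => T _; exact: closed_eval_ge.
- by apply: closed_bigI => T _; exact: closed_eval_eq.
- exact: closed_eval_eq.
- by apply: closed_bigI => T _; exact: closed_eval_eq.
Qed.

Lemma real_state_compact : compact [set f | real_state f].
Proof.
have /choice[c hc] := real_state_bound.
apply: subclosed_compact; first exact: real_state_closed.
- exact: (@tychonoff (H -> H) (fun=> R) (fun T => `[- c T, c T]%classic)
    (fun T => @segment_compact _ _ _)).
- by move=> f sf T; exact: hc.
Qed.

Lemma vector_real_state h : rdot h h = 1 ->
  real_state (fun T => if `[< M T >] then rdot (T h) h else 0).
Proof.
move=> h1; split.
- move=> a S T MS MT; have MST := ca_lin cM a%:C%C MS MT.
  do 3 (case: asboolP => //= _).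
  change (rdot (a *r S h + T h) h = a * rdot (S h) h + rdot (T h) h).
  by rewrite rdotDl rdotZl.
- move=> T MT pT; have MiT := ca_Z cM 'i%C MT.
  do 2 (case: asboolP => // _); split; first exact: positive_nonneg.
  change (Re (dot ('i%C *: T h) h) = 0); rewrite linearZl_LR /= cReM /=.
  by have := pT.2 h; rewrite ge0_ReIm => /andP[_ /eqP ->]; rewrite mul0r mulr0 subr0.
- by case: asboolP => // -[]; exact: ca_id.
- by move=> T nMT; case: asboolP.
Qed.

(** Normalized vectors at which [K] is small give states with small values at
    [K], so that the smallest value over the compact set of states is [0]. *)
Lemma extreme_real_state K : M K -> pos K ->
  (forall d, 0 < d -> exists2 h, h <> 0 & rdot (K h) h < d * rdot h h) ->
  exists f, [/\ real_state f, f K = 0 & forall g g' t, real_state g -> real_state g' -> 0 < t < 1 ->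
    f = mix t g g' -> g = f /\ g' = f].
Proof.
move=> MK pK low.
have vec d : 0 < d -> exists2 f, real_state f & f K < d.
  move=> /low[h h0 hd]; have n0 := rnorm_gt0 h0.
  have MLK := ca_linear cM MK.
  pose u := (rnorm h)^-1 *r h.
  have u1 : rdot u u = 1.
    by rewrite rdotZl rdotZr -(rnorm_sqr hdot) expr2; field; rewrite lt0r_neq0.
  exists (fun T => if `[< M T >] then rdot (T u) u else 0); first exact: vector_real_state.
  case: asboolP => //= _; rewrite /u (linZ MLK) rdotZl rdotZr mulrA -expr2 exprVn mulrC.
  by rewrite ltr_pdivrMr ?exprn_gt0// (rnorm_sqr hdot).
have cK := real_state_compact.
have fK : face [set f | real_state f] [set f | real_state f].
  split=> //; first exact: real_state_closed.
  by have [f sf _] := vec 1 ltr01; exists f.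
have [f [sf fmin] ext] := extreme_point_in_face cK (face_argmin K cK fK).
exists f; split=> //.
have f0 : 0 <= f K by case: sf => _ /(_ _ MK pK)[].
apply/eqP; rewrite eq_le f0 andbT; apply/ler_addgt0Pr => e e0; rewrite add0r.
by have [g sg ge] := vec e e0; apply: le_trans (fmin g sg) (ltW ge).
Qed.

End RealStates.

(** * Pure states *)

Section ComplexPositivity.
Context {R : realType}.

Lemma gt0_real (z : R[i]) : 0 < z -> z = (Re z)%:C%C /\ 0 < Re z.
Proof.
rewrite ltcE => /andP[/eqP iz rz]; split=> //.
exact: complex_ext.
Qed.

(** As [e] is small of either sign, the linear term must vanish. *)
Lemma quadratic_ge0_eq0 (z w : R[i]) : 0 <= w ->
  (forall e : R, 0 <= e%:C%C * z + (e ^+ 2)%:C%C * w) -> z = 0.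
Proof.
rewrite ge0_ReIm => /andP[w0 /eqP iw] h.
have h' e : 0 <= e * Re z + e ^+ 2 * Re w /\ e * Im z = 0.
  have := h e; rewrite ge0_ReIm cReD cImD !cReM !cImM /= iw => /andP[a /eqP b]; lra.
apply: complex_ext => /=; last by have [_] := h' 1; rewrite mul1r.
have [+ _] := h' (- Re z / (Re w + 1)).
have w1 : 0 < Re w + 1 by lra.
have -> : - Re z / (Re w + 1) * Re z + (- Re z / (Re w + 1)) ^+ 2 * Re w =
  - (Re z / (Re w + 1)) ^+ 2 by field; lra.
rewrite oppr_ge0 => le0.
have : (Re z / (Re w + 1)) ^+ 2 == 0 by rewrite eq_le le0 sqr_ge0.
by rewrite sqrf_eq0 mulf_eq0 invr_eq0 (gt_eqF w1) orbF => /eqP.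
Qed.

(** Real and imaginary [a] give [u + v = 0] and [v - u = 0]. *)
Lemma sesquilinear_ge0_eq0 (u v w : R[i]) : 0 <= w ->
  (forall a : R[i], 0 <= a * v + a^*%C * u + (a * a^*%C) * w) -> u = 0 /\ v = 0.
Proof.
move=> w0 h.
have s0 : v + u = 0.
  apply: (quadratic_ge0_eq0 w0) => e; have := h e%:C%C.
  rewrite conjc_real -mulrDr -rmorphM /= -expr2; exact.
have d0 : 'i%C * (v - u) = 0.
  apply: (quadratic_ge0_eq0 w0) => e; have := h (e%:C%C * 'i%C).
  have -> : ((e%:C%C * 'i%C)^*)%C = - (e%:C%C * 'i%C) :> R[i].
    by apply: complex_ext; rewrite /= ; lra.
  have -> : e%:C%C * 'i%C * - (e%:C%C * 'i%C) = (e ^+ 2)%:C%C :> R[i].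
    by apply: complex_ext; rewrite /= ; lra.
  by rewrite mulrBr mulNr mulrBr !mulrA.
have i0 : ('i%C : R[i]) != 0 by rewrite eq_complex /= oner_eq0 andbF.
move/eqP: d0; rewrite mulf_eq0 (negPf i0) /= subr_eq0 => /eqP e.
move/eqP: s0; rewrite e -mulr2n mulrn_eq0 /= => /eqP u0.
by rewrite u0.
Qed.
End ComplexPositivity.

Section PureStates.
Context {R : realType} {H : completeNormedModType R[i]}.
Variables (dot : {dot H for Num.conj}) (hdot : hilbert_dot dot).
Variables (M : set (H -> H)) (hM : von_neumann_algebra dot M).
Implicit Types (x y : H) (S T L A B C D K X Y N : H -> H) (f g : (H -> H) -> R[i]).
Local Notation rdot := (rdot dot).
Local Notation selfadj := (selfadj dot).
Local Notation pos := (positive_operator dot).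
Local Notation state := (state dot M).
Local Notation pure_state := (pure_state dot M).
Local Notation I := (idfun : H -> H).
Local Notation fspace := ({ptws (H -> H) -> R}).
Let cM : closed_algebra M := vna_closed_algebra hdot hM.

Section StateTheory.
Variables (f : (H -> H) -> R[i]) (sf : state f).

Lemma stateD S T : M S -> M T -> f (S + T) = f S + f T.
Proof. by case: sf => lf _ _ MS MT; have := lf 1 S T MS MT; rewrite scale1r mul1r. Qed.

Lemma state0 : f 0 = 0.
Proof. by apply: (addrI (f 0)); rewrite -stateD ?addr0//; exact: ca_0. Qed.

Lemma stateZ (a : R[i]) T : M T -> f (a *: T) = a * f T.
Proof.
by case: sf => lf _ _ MT; have := lf a T 0 MT (ca_0 cM); rewrite state0 !addr0.
Qed.

Lemma stateB S T : M S -> M T -> f (S - T) = f S - f T.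
Proof.
by move=> MS MT; rewrite -scaleN1r stateD ?(stateZ, mulN1r)//; exact: (ca_Z cM).
Qed.

(** The Cauchy-Schwarz inequality for [f] in the degenerate case. Expanding
    [f] at [(N + a Y')' (N + a Y')], with [N'] and [Y'] the adjoints, leaves a
    nonnegative quadratic expression in [a] without constant term. *)
Lemma state_null N N' : M N -> M N' -> is_adjoint dot N N' -> f (N' \o N) = 0 ->
  forall Y, M Y -> f (Y \o N) = 0 /\ f (N' \o Y) = 0.
Proof.
move=> MN MN' aN f0.
have key Y Y' : M Y -> M Y' -> is_adjoint dot Y Y' -> f (Y \o N) = 0 /\ f (N' \o Y') = 0.
  move=> MY MY' aY; case: sf => lf pf f1.
  have lN' := ca_linear cM MN'; have lY := ca_linear cM MY.
  have MC := ca_comp cM.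
  apply: (@sesquilinear_ge0_eq0 _ _ _ (f (Y \o Y'))).
    apply: pf; first exact: MC.
    by apply: adjoint_comp_positive => //; [exact: (ca_bd cM)|exact: (ca_bd cM)|exact: adjointC].
  move=> a.
  have -> : a * f (N' \o Y') + a^*%C * f (Y \o N) + a * a^*%C * f (Y \o Y') =
      f ((a^*%C *: Y + N') \o (a *: Y' + N)).
    have -> : (a^*%C *: Y + N') \o (a *: Y' + N) =
        a *: (N' \o Y') + (a^*%C *: (Y \o N) + ((a * a^*%C) *: (Y \o Y') + (N' \o N))).
      apply/funext => x.
      change (a^*%C *: Y (a *: Y' x + N x) + N' (a *: Y' x + N x) =
       a *: N' (Y' x) + (a^*%C *: Y (N x) + ((a * a^*%C) *: Y (Y' x) + N' (N x)))).
      apply: (rdot_ext hdot) => z; rewrite lY lN' !rdotE; congr (Re _).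
      rewrite !(dotDl, dotZl); ring.
    rewrite !lf//; do ?[exact: MC | apply: (ca_lin cM)]; rewrite ?f0 ?addr0 ?addrA//.
    all: try exact: MC.
  apply: pf.
    by apply: MC; apply: (ca_lin cM).
  apply: (adjoint_comp_positive hdot).
  - by apply: (ca_bd cM); apply: (ca_lin cM).
  - by apply: (ca_bd cM); apply: (ca_lin cM).
  move=> x y; change (dot (a *: Y' x + N x) y = dot x (a^*%C *: Y y + N' y)).
  by rewrite dotDl dotZl dotDr dotZr conjcK (adjointC aY) aN.
move=> Y MY; have [Y' MY' aY] := vna_adj hM MY.
by split; [exact: (key Y Y' MY MY' aY).1|exact: (key Y' Y MY' MY (adjointC aY)).2].
Qed.

End StateTheory.

(** The complex-linear functional with real part [p]. *)
Definition complexify (p : fspace) : (H -> H) -> R[i] :=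
  fun T => (p T +i* (- p ('i%C *: T)))%C.

Lemma complexify_state (p : fspace) : real_state dot M p -> state (complexify p).
Proof.
move=> sp; have [lp pp p1 _] := sp; have M1 := ca_id cM.
have iT T : M T -> M ('i%C *: T) := @ca_Z _ _ _ cM 'i%C T.
split.
- move=> [a b] S T MS MT.
  have e : forall S, (a +i* b)%C *: S = a%:C%C *: S + b%:C%C *: ('i%C *: S).
    move=> S'; rewrite scalerA -scalerDl; congr (_ *: _).
    by apply: complex_ext => /=; ring.
  have p2 S' T' : M S' -> M T' -> p ((a +i* b)%C *: S' + T') =
      a * p S' + (b * p ('i%C *: S') + p T').
    move=> MS' MT'; rewrite e -addrA lp//; last by apply: (ca_lin cM) => //; exact: iT.
    by rewrite lp//; exact: iT.
  have MiS := iT S MS; have MiT := iT T MT.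
  rewrite /complexify p2// scalerDr scalerA ['i%C * _]mulrC -scalerA p2//. 
  have -> : p ('i%C *: ('i%C *: S)) = - p S.
    by rewrite scalerA -expr2 sqr_i -(rmorphN1 (real_complex R)) (real_stateZ hdot hM sp)// mulN1r.
  by apply: complex_ext => /=; ring.
- move=> T MT pT; have [h1 h2] := pp T MT pT.
  by rewrite ge0_ReIm /= h1 h2 oppr0 eqxx.
- have := real_state_selfadj hdot hM sp (c := 1) M1 (fun x y => erefl).
  move=> [|_ i0]; first by move=> h; rewrite mul1r.
  by rewrite /complexify p1 i0 oppr0.
Qed.

Definition realpart f : fspace := fun T => if `[< M T >] then Re (f T) else 0.

Lemma realpart_real_state f : state f -> real_state dot M (realpart f).
Proof.
move=> sf; have [lf pf f1] := sf; split.
- move=> a S T MS MT; have MST := ca_lin cM a%:C%C MS MT.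
  rewrite /realpart; do 3 (case: asboolP => //= _).
  by rewrite lf// cReD cReZ.
- move=> T MT pT; have MiT := ca_Z cM 'i%C MT.
  rewrite /realpart; do 2 (case: asboolP => // _).
  have := pf T MT pT; rewrite ge0_ReIm => /andP[h /eqP i0]; split=> //.
  by rewrite (stateZ sf)// cReM i0 /=; lra.
- by rewrite /realpart; case: asboolP => [_|[]]; [rewrite f1|exact: ca_id].
- by move=> T nMT; rewrite /realpart; case: asboolP.
Qed.

Lemma realpart_complexify f : state f -> forall T, M T ->
  f T = complexify (realpart f) T.
Proof.
move=> sf T MT; have MiT := ca_Z cM 'i%C MT.
rewrite /complexify /realpart; do 2 (case: asboolP => // _).
by rewrite (stateZ sf)// cReM /=; apply: complex_ext => /=; lra.
Qed.

(** Taking real parts identifies convex decompositions of states with those of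
    real states, so that extreme points correspond. *)
Lemma pure_state_vanishing K : M K -> pos K ->
  (forall d, 0 < d -> exists2 h, h <> 0 & rdot (K h) h < d * rdot h h) ->
  exists2 f, pure_state f & f K = 0.
Proof.
move=> MK pK low; have [p [sp p0 ext]] := extreme_real_state hdot hM MK pK low.
have sf := complexify_state sp.
exists (complexify p); last first.
  by case: (sp) => _ /(_ _ MK pK)[_ i0] _ _; rewrite /complexify p0 i0 oppr0.
split=> // g h t sg sh t01 e.
have [eg eh] : realpart g = p /\ realpart h = p.
  apply: (ext _ _ t) => //; try exact: realpart_real_state.
  apply/funext => T; rewrite /mix /realpart; case: asboolP => MT; last first.
    by case: sp => _ _ _ /(_ _ MT) ->; ring.
  by have := congr1 (@complex.Re R) (e T MT); rewrite cReD !cReZ.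
by move=> T MT; rewrite (realpart_complexify sg MT) (realpart_complexify sh MT) eg eh.
Qed.

Section Compression.
Variables (C D : H -> H).
Hypotheses (MC : M C) (MD : M D) (sC : selfadj C) (sD : selfadj D).
Hypotheses (CD : forall x, C (D x) = x) (DC : forall x, D (C x) = x).

(** If [f(D D)] were zero, [f] would vanish on [C D = 1]. *)
Lemma compress_gt0 f : state f -> 0 < f (D \o D).
Proof.
move=> sf; have [lf pf f1] := sf.
have aD : is_adjoint dot D D := selfadj_adjoint (ca_linear cM MD) sD.
have MDD := ca_comp cM MD MD.
have pDD := adjoint_comp_positive hdot (ca_bd cM MD) (ca_bd cM MD) aD.
rewrite lt0r (pf _ MDD pDD) andbT; apply/eqP => /(state_null sf MD MD aD)/(_ C MC)[+ _].
have -> : C \o D = I by apply/funext.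
by rewrite f1 => /eqP; rewrite oner_eq0.
Qed.

Definition compress f : (H -> H) -> R[i] := fun X => f (D \o X \o D) / f (D \o D).

Lemma compress_state f : state f -> state (compress f).
Proof.
move=> sf; have [lf pf f1] := sf; have d0 := compress_gt0 sf.
have lD := ca_linear cM MD.
have MDX X : M X -> M (D \o X \o D).
  by move=> MX; apply: (ca_comp cM) => //; exact: (ca_comp cM).
split.
- move=> a S T MS MT; rewrite /compress.
  have -> : D \o (a *: S + T) \o D = a *: (D \o S \o D) + (D \o T \o D).
    by apply/funext => x; exact: lD.
  rewrite lf; [|exact: MDX|exact: MDX].
  by rewrite mulrDl mulrA.
- move=> T MT pT; apply: divr_ge0; last exact: ltW.
  apply: pf; first exact: MDX.
  split; first by apply: (ca_bd cM); exact: MDX.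
  by move=> h /=; rewrite (selfadj_adjoint lD sD); exact: pT.2.
by rewrite /compress divff// gt_eqF.
Qed.
End Compression.

(** Purity means that the state spans an extreme ray of the cone of positive
    functionals, and [f |-> f(D . D)] is an automorphism of this cone, with
    inverse [f |-> f(C . C)]. The normalizations change the weights of a convex
    decomposition, not its being one. *)
Lemma compress_pure C D f : M C -> M D -> selfadj C -> selfadj D ->
  (forall x, C (D x) = x) -> (forall x, D (C x) = x) ->
  pure_state f -> pure_state (compress D f).
Proof.
move=> MC MD sC sD CD DC [sf ext]; split; first exact: (compress_state MC).
move=> g h t sg sh /andP[t0 t1] e.
have M1 := ca_id cM.
have MCX X : M X -> M (C \o X \o C).
  by move=> MX; apply: (ca_comp cM) => //; exact: (ca_comp cM).
have MDX X : M X -> M (D \o X \o D).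
  by move=> MX; apply: (ca_comp cM) => //; exact: (ca_comp cM).
have [gE G0] := gt0_real (compress_gt0 MD MC sC DC sg).
have [hE H0] := gt0_real (compress_gt0 MD MC sC DC sh).
have [dE d0] := gt0_real (compress_gt0 MC MD sD CD sf).
move: gE hE dE G0 H0 d0.
set G := Re (g _); set H' := Re (h _); set d := Re (f _) => gE hE dE G0 H0 d0.
have DCXCD X : D \o (C \o X \o C) \o D = X.
  by apply/funext => x /=; rewrite CD DC.
have CDXDC X : C \o (D \o X \o D) \o C = X.
  by apply/funext => x /=; rewrite DC CD.
have nz (a : R) : 0 < a -> (a%:C%C : R[i]) != 0.
  by move=> a0; rewrite eq_complex /= eqxx andbT gt_eqF.
have gX X : g (C \o X \o C) = G%:C%C * compress C g X.
  by rewrite /compress gE mulrC divfK// nz.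
have hX X : h (C \o X \o C) = H'%:C%C * compress C h X.
  by rewrite /compress hE mulrC divfK// nz.
have fX X : M X -> f X = (d * t * G)%:C%C * compress C g X + (d * (1 - t) * H')%:C%C * compress C h X.
  move=> MX; have := e _ (MCX X MX).
  rewrite {1}/compress DCXCD dE gX hX => /(congr1 (fun z => d%:C%C * z)).
  rewrite mulrC divfK ?nz// => ->.
  by rewrite mulrDr !mulrA -!rmorphM.
have sg1 := compress_state MD MC sC DC sg; have sh1 := compress_state MD MC sC DC sh.
have sum1 : d * t * G + d * (1 - t) * H' = 1.
  have := fX I M1; case: (sf) => _ _ ->; case: (sg1) => _ _ ->; case: (sh1) => _ _ ->.
  by rewrite !mulr1 -rmorphD => /(congr1 (@complex.Re R)).
have s0 : 0 < d * t * G by rewrite !mulr_gt0.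
have s1 : 0 < d * (1 - t) * H' by rewrite !mulr_gt0// subr_gt0.
have gh1 : forall X, M X -> compress C g X = f X /\ compress C h X = f X.
  apply: (ext _ _ (d * t * G)) => //; first by rewrite s0 /=; lra.
  by move=> X MX; rewrite fX//; congr (_ + _%:C%C * _); lra.
(* [g] and [h] are recovered from their compressions by [C], which equal [f] *)
have fin k (K : R) : state k -> 0 < K ->
    (forall X, k (C \o X \o C) = K%:C%C * compress C k X) ->
    (forall X, M X -> compress C k X = f X) -> forall X, M X -> k X = compress D f X.
  move=> [_ _ k1] K0 kX ck X MX.
  have kE Y : M Y -> k Y = K%:C%C * f (D \o Y \o D).
    by move=> MY; rewrite -[Y in LHS]CDXDC kX ck//; exact: MDX.
  have := kE I M1; rewrite k1 => k1'.
  rewrite kE// /compress dE; move: k1'; rewrite -/(D \o D) dE => k1'.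
  by rewrite [RHS]mulrC; congr (_ * _); apply: (mulIf (nz _ d0)); rewrite -k1' mulVf ?nz.
move=> X MX; split; first by apply: (fin _ G) => // Y /gh1[].
by apply: (fin _ H') => // Y /gh1[].
Qed.

End PureStates.

(** * The A-spectrum of an operator *)

Section Core.
Context {R : realType} {H : completeNormedModType R[i]}.
Variables (dot : {dot H for Num.conj}) (hdot : hilbert_dot dot).
Variables (M : set (H -> H)) (hM : von_neumann_algebra dot M).
Implicit Types (x y h : H) (S T L X Y N : H -> H) (f g : (H -> H) -> R[i]).
Local Notation rdot := (rdot dot).
Local Notation selfadj := (selfadj dot).
Local Notation pos := (positive_operator dot).
Local Notation I := (idfun : H -> H).
Let cM : closed_algebra M := vna_closed_algebra hdot hM.

(** [E] is the projection onto the kernel of [A], and [A = C^2 (1 - E)] with [C]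
    invertible, of inverse [D], and commuting with [E]. *)
Variables A E C D : H -> H.
Hypotheses (MA : M A) (ME : M E) (MC : M C) (MD : M D).
Hypotheses (sC : selfadj C) (sD : selfadj D).
Hypotheses (EE : forall h, E (E h) = E h) (AE : forall h, A (E h) = 0).
Hypotheses (CD : forall h, C (D h) = h) (DC : forall h, D (C h) = h).
Hypotheses (EC : forall h, E (C h) = C (E h)) (AC : forall h, A h = C (C (h - E h))).
Hypotheses (sqrtA : op_sqrt dot A = C \o (I - E)).
Hypotheses (normA : forall h, Anorm dot A h = rnorm (C (h - E h))).

Let lA := ca_linear cM MA.
Let lE := ca_linear cM ME.
Let lC := ca_linear cM MC.
Let lD := ca_linear cM MD.

Lemma ED h : E (D h) = D (E h).
Proof. by rewrite -[LHS]DC -EC CD. Qed.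

Lemma DDA h : D (D (A h)) = h - E h.
Proof. by rewrite AC !DC. Qed.

Lemma EA h : E (A h) = 0.
Proof. by rewrite AC !EC (linB lE) EE subrr !(lin0 lC). Qed.

Lemma AP h : A (h - E h) = A h.
Proof. by rewrite (linB lA) AE subr0. Qed.

(** The bound is the supremum itself, or [0] when the supremum is over the empty
    set. *)
Lemma Abounded_bound T : Abounded dot M A T -> exists c : R, forall h,
  Anorm dot A h = 1 -> Anorm dot A (T h) <= c.
Proof.
move=> [_ Tfin].
have [c hc] : exists c : R, (Aopnorm dot A T <= c%:E)%E.
  by case: (Aopnorm dot A T) Tfin => [r _|//|_]; [exists r|exists 0; rewrite leNye].
exists c => h h1; rewrite -lee_fin; apply: le_trans hc.
by apply: ereal_sup_ubound; exists h.
Qed.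

(** Adding multiples of [E h] to a vector [k] with [|k|_A = 1] does not change
    [|k|_A], while [|T k + n T (E h)|_A] stays bounded only if [|T (E h)|_A = 0]. *)
Lemma Abounded_ker T : A <> 0 -> Abounded dot M A T -> forall h, A (T (E h)) = 0.
Proof.
move=> A0 bT h; have [MT _] := bT; have lT := ca_linear cM MT.
have [c hc] := Abounded_bound bT.
pose B v := C (v - E v).
have BD u v : B (u + v) = B u + B v by rewrite /B (linD lE) opprD addrACA (linD lC).
have BZ (a : R[i]) v : B (a *: v) = a *: B v by rewrite /B (linZ lE) -scalerBr (linZ lC).
have BE v : B (E v) = 0 by rewrite /B EE subrr (lin0 lC).
have [k0 Bk0] : exists k0, B k0 <> 0.
  apply: contrapT => nB; apply: A0; apply/funext => v.
  rewrite AC; have [->|Bv] := pselect (C (v - E v) = 0); first by rewrite (lin0 lC).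
  by exfalso; apply: nB; exists v.
have nB := rnorm_gt0 Bk0.
have [k k1] : exists k, rnorm (B k) = 1.
  by exists ((rnorm (B k0))^-1 *r k0); rewrite BZ rnormZ gtr0_norm ?invr_gt0// mulVf// gt_eqF.
have B0 : B (T (E h)) = 0.
  apply: rnorm_eq0; apply/eqP; rewrite eq_le rnorm_ge0 andbT leNgt; apply/negP => n0.
  set m := rnorm (B (T (E h))) in n0.
  pose n := (c + rnorm (B (T k)) + 1) / m.
  have := hc (k + n *r E h); rewrite !normA -!/(B _) BD BZ BE scaler0 addr0 => /(_ k1).
  rewrite (linD lT) (linZ lT) BD BZ => le_c.
  have := rnormB (B (T k) + n *r B (T (E h))) (B (T k)).
  rewrite addrAC subrr add0r rnormZ -/m.
  have : n * m <= `|n| * m by rewrite ler_wpM2r ?ler_norm// ltW.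
  have -> : n * m = c + rnorm (B (T k)) + 1 by rewrite /n divfK// gt_eqF.
  lra.
by rewrite AC -/(B _) B0 (lin0 lC).
Qed.

Section Fixed.
Variables (T : H -> H) (l : R[i]).
Hypotheses (MT : M T) (ATE : forall h, A (T (E h)) = 0).
Let lT := ca_linear cM MT.

Lemma ATP h : A (T (h - E h)) = A (T h).
Proof. by rewrite (linB lT) (linB lA) ATE subr0. Qed.

(** [D D] inverts [A] up to [E], and [E] is absorbed by [S0] on its right and by
    [A T] likewise. *)
Lemma corner_products S0 : (forall h, S0 (E h) = 0) -> linear S0 ->
  D \o (A \o S0 \o T) \o D = (D \o (A \o S0) \o D) \o (D \o (A \o T) \o D) /\
  D \o (A \o T \o S0) \o D = (D \o (A \o T) \o D) \o (D \o (A \o S0) \o D).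
Proof.
move=> S0E lS; split; apply/funext => h /=; rewrite DDA.
  by rewrite (linB lS) S0E subr0.
by rewrite ATP.
Qed.

(** [B T] times the pseudo-inverse of [B], for [B] the square root of [A]: the
    operator induced by [T] on the range of [A], transported by [B]. *)
Definition corner_op := D \o (A \o T) \o D.
(** [l] minus the induced operator on the range of [A], completed by the identity
    on the kernel so that its invertibility can be discussed in [M]. *)
Definition corner_shift : H -> H := l *: (I - E) + E - corner_op.

Lemma M_corner_op : M corner_op.
Proof. exact: (ca_comp cM (ca_comp cM MD (ca_comp cM MA MT)) MD). Qed.

Lemma M_corner_shift : M corner_shift.
Proof.
apply: (ca_B cM); last exact: M_corner_op.
by apply: (ca_lin cM) => //; apply: (ca_B cM) => //; exact: ca_id.
Qed.

Lemma corner_shiftE h : corner_shift h = l *: (h - E h) + E h - corner_op h. Proof. by []. Qed.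

Lemma corner_op_ker h : corner_op (E h) = 0.
Proof. by rewrite /corner_op /= -ED ATE (lin0 lD). Qed.

Lemma ker_corner_op h : E (corner_op h) = 0.
Proof. by rewrite /corner_op /= ED EA (lin0 lD). Qed.

Lemma corner_shift_ker h : corner_shift (E h) = E h.
Proof. by rewrite corner_shiftE EE subrr scaler0 add0r corner_op_ker subr0. Qed.

Lemma ker_corner_shift h : E (corner_shift h) = E h.
Proof.
by rewrite corner_shiftE (linB lE) ker_corner_op subr0 (linD lE) (linZ lE) (linB lE) !EE subrr scaler0 add0r.
Qed.

Local Notation lmT := (l *: I - T).

Lemma corner_shift_resolvent h : D (A (l *: h - T h)) = corner_shift (C h) - E (C h).
Proof.
rewrite (linB lA) (linZ lA) (linB lD) (linZ lD) corner_shiftE /corner_op /= DC.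
have -> : D (A h) = C h - E (C h) by rewrite AC DC (linB lC) EC.
by rewrite addrAC addrK.
Qed.

(** The candidate is [D L C]. Its [A]-norm is bounded because [C (1 - E) D L C h]
    only depends on [C (1 - E) h]: the inverse [L] is the identity on the kernel. *)
Lemma Ainvertible_of_inverse L : M L ->
  (forall h, L (corner_shift h) = h) -> (forall h, corner_shift (L h) = h) ->
  Ainvertible dot M A lmT.
Proof.
move=> ML LN NL; have lL := ca_linear cM ML.
have EL h : E (L h) = E h by rewrite -ker_corner_shift NL.
have LE h : L (E h) = E h by rewrite -{1}corner_shift_ker LN.
pose S := D \o L \o C.
have MS : M S := ca_comp cM (ca_comp cM MD ML) MC.
have lS := ca_linear cM MS.
exists S.
  split=> //.
  have [_ [c c0 bc]] := bounded_operator_bound (ca_bd cM (ca_comp cM (ca_B cM (ca_id cM) ME) ML)).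
  apply: (@le_lt_trans _ _ (c%:E)%E); last exact: ltry.
  apply: ge_ereal_sup => _ [h h1 <-]; rewrite lee_fin.
  move: h1; rewrite /= !normA => h1.
  rewrite -[c]mulr1 -h1.
  have -> : C (D (L (C h)) - E (D (L (C h)))) = L (C (h - E h)) - E (L (C (h - E h))).
    rewrite (linB lC) CD -EC CD EL.
    by rewrite (linB lC) -EC (linB lL) LE (linB lE) EL EE subrr subr0.
  exact: bc.
split; apply/funext => h.
  change (A (l *: S h - T (S h)) = A h).
  by rewrite -[LHS]CD corner_shift_resolvent /S /= CD NL EL EC -(linB lC) -AC.
change (A (D (L (C (l *: h - T h)))) = A h).
set v := l *: h - T h.
have -> : A (D (L (C v))) = A (D (L (D (A v)))).
  have -> : D (A v) = C v - E (C v) by rewrite [A v]AC DC (linB lC) EC.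
  by rewrite (linB lL) LE (linB lD) (linB lA) -ED AE subr0.
by rewrite /v corner_shift_resolvent (linB lL) LN LE (linB lD) (linB lA) -ED AE subr0 DC.
Qed.


Lemma inverse_or_low K : M K -> selfadj K ->
  (exists2 S, M S & S \o K = I /\ K \o S = I) \/
  (forall d, 0 < d -> exists2 h, h <> 0 & rdot (K h) h < d * rdot h h).
Proof.
move=> MK sK.
have [[d d0 hd]|nd] := pselect (exists2 d, 0 < d & forall h, d * rdot h h <= rdot (K h) h).
  by left; exact: (inverse_of_below hdot cM MK sK d0 hd).
right=> d d0; apply: contrapT => nh; apply: nd; exists d => // h.
rewrite leNgt; apply/negP => lt; apply: nh; exists h => // h0.
by move: lt; rewrite h0 (lin0 (ca_linear cM MK)) !rdot0l mulr0 ltxx.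
Qed.

(** With [N] for [corner_shift] and [N'] for its adjoint: if both [N' N] and [N N']
    were invertible, [N] would have a left and a right inverse. *)
Lemma null_state_of_not_Ainvertible : ~ Ainvertible dot M A lmT ->
  exists2 f, pure_state dot M f &
    (forall Y, M Y -> f (Y \o corner_shift) = 0) \/ (forall Y, M Y -> f (corner_shift \o Y) = 0).
Proof.
move=> nA; have MN := M_corner_shift; have [N' MN' aN] := vna_adj hM MN.
have aN' := adjointC aN; have MC' := ca_comp cM.
have bM X : M X -> bounded_operator X := @ca_bd _ _ _ cM X.
have p1 := adjoint_comp_positive hdot (bM _ MN) (bM _ MN') aN.
have p2 := adjoint_comp_positive hdot (bM _ MN') (bM _ MN) aN'.
have [[L ML [L1 _]]|low] := inverse_or_low (MC' _ _ MN' MN) (positive_selfadj p1); last first.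
  have [f pf f0] := pure_state_vanishing hdot hM (MC' _ _ MN' MN) p1 low.
  exists f => //; left=> Y MY.
  by have [] := state_null hdot hM pf.1 MN MN' aN f0 MY.
have [[L2 ML2 [_ L2r]]|low] := inverse_or_low (MC' _ _ MN MN') (positive_selfadj p2); last first.
  have [f pf f0] := pure_state_vanishing hdot hM (MC' _ _ MN MN') p2 low.
  exists f => //; right=> Y MY.
  by have [] := state_null hdot hM pf.1 MN' MN aN' f0 MY.
case: nA; apply: (@Ainvertible_of_inverse (L \o N')); first exact: MC'.
  by move=> h; exact: (congr1 (@^~ h) L1).
have rinv h : corner_shift (N' (L2 h)) = h by exact: (congr1 (@^~ h) L2r).
have linv h : L (N' (corner_shift h)) = h by exact: (congr1 (@^~ h) L1).
by move=> h /=; rewrite -{1}(rinv h) linv rinv.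
Qed.

Lemma sqrt_cornerP S0 : sqrt_corner dot M A S0 ->
  [/\ M S0, linear S0 & forall h, S0 (E h) = 0].
Proof.
move=> [X MX <-]; rewrite sqrtA.
have MB : M (C \o (I - E)) by apply: (ca_comp cM) => //; apply: (ca_B cM) => //; exact: ca_id.
have M0 : M ((C \o (I - E)) \o X \o (C \o (I - E))).
  by apply: (ca_comp cM) => //; exact: ca_comp.
split=> //; first exact: (ca_linear cM).
move=> h; change (C (X (C (E h - E (E h))) - E (X (C (E h - E (E h))))) = 0).
by rewrite EE subrr (lin0 lC) (lin0 (ca_linear cM MX)) (lin0 lE) subr0 (lin0 lC).
Qed.

Lemma exists_PA_of_not_Ainvertible : ~ Ainvertible dot M A lmT ->
  exists2 g, PA dot M A T g & g (A \o T) = l.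
Proof.
move=> nA; have [f pf hf] := null_state_of_not_Ainvertible nA.
have sf := pf.1; have [lf _ f1] := sf.
have M1 := ca_id cM; have MIE : M (I - E) := ca_B cM M1 ME.
have MN := M_corner_shift; have MWW := M_corner_op.
have fE Y : M Y -> (forall Z, M Z -> f (Z \o corner_shift) = 0) -> f (Y \o E) = 0.
  move=> MY h.
  have -> : Y \o E = (Y \o E) \o corner_shift by apply/funext => x /=; rewrite ker_corner_shift.
  by apply: h; exact: (ca_comp cM).
have fE' Y : M Y -> (forall Z, M Z -> f (corner_shift \o Z) = 0) -> f (E \o Y) = 0.
  move=> MY h.
  have -> : E \o Y = corner_shift \o (E \o Y) by apply/funext => x /=; rewrite corner_shift_ker.
  by apply: h; exact: (ca_comp cM).
have [fE0 fN0] : f E = 0 /\ f corner_shift = 0.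
  by case: hf => h; [split; [exact: (fE I)|exact: (h I)]|split; [exact: (fE' I)|exact: (h I)]].
have fP : f (I - E) = 1 by rewrite (stateB hdot hM sf)// f1 fE0 subr0.
have WN : corner_op = l *: (I - E) + (E - corner_shift).
  by apply/funext => h; change (corner_op h = l *: (h - E h) + (E h - (l *: (h - E h) + E h - corner_op h)));
     rewrite opprB addrA addrC subrK.
have fW : f corner_op = l.
  rewrite WN lf//; last exact: (ca_B cM).
  by rewrite fP (stateB hdot hM sf)// fE0 fN0 subrr addr0 mulr1.
have dd := compress_gt0 hdot hM MC MD sD CD sf.
have ddn : f (D \o D) != 0 by rewrite gt_eqF.
pose p := compress D f.
have pp : pure_state dot M p := compress_pure hdot hM MC MD sC sD CD DC pf.
have pA : p A = (f (D \o D))^-1.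
  rewrite /p /compress; have -> : D \o A \o D = I - E.
    by apply/funext => h; change (D (A (D h)) = h - E h); rewrite AC DC (linB lC) CD -EC CD.
  by rewrite fP mul1r.
have pAn : p A != 0 by rewrite pA invr_eq0.
pose g X := p X / p A.
have gE X : g X = f (D \o X \o D) by rewrite /g pA invrK /p /compress divfK.
have gT : g (A \o T) = l by rewrite gE.
have Pg : Apure_states dot M A g by exists p.
exists g => //.
case: hf => hf; [left|right]; split=> // S0 cS; have [MS lS SE] := sqrt_cornerP cS;
  have [e1 e2] := corner_products SE lS; rewrite gT !gE ?e1 ?e2;
  set V := D \o (A \o S0) \o D;
  have MV : M V := ca_comp cM (ca_comp cM MD (ca_comp cM MA MS)) MD;
  have lV := ca_linear cM MV;
  have VE h : V (E h) = 0 by rewrite /V /= -ED SE (lin0 lA) (lin0 lD).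
- have -> : V \o corner_op = l *: V - (V \o corner_shift).
    apply/funext => h; change (V (corner_op h) = l *: V h - V (corner_shift h)).
    by rewrite corner_shiftE (linB lV) (linD lV) (linZ lV) (linB lV) VE subr0 addr0 subKr.
  rewrite (stateB hdot hM sf) ?hf//; first by rewrite (stateZ hdot hM sf)// subr0.
    exact: (ca_Z cM).
  exact: (ca_comp cM).
have EV h : E (V h) = 0 by rewrite /V /= ED EA (lin0 lD).
have -> : corner_op \o V = l *: V - (corner_shift \o V).
  apply/funext => h; change (corner_op (V h) = l *: V h - corner_shift (V h)).
  by rewrite corner_shiftE EV subr0 addr0 subKr.
rewrite (stateB hdot hM sf) ?hf//; first by rewrite (stateZ hdot hM sf)// subr0.
  exact: (ca_Z cM).
exact: (ca_comp cM).
Qed.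

(** Both conditions are tested at [S0 = P S P], for [S] an [A]-inverse. *)
Lemma PA_not_Ainvertible g : PA dot M A T g -> g (A \o T) = l ->
  ~ Ainvertible dot M A lmT.
Proof.
move=> Pg gT [S bS [eS1 eS2]].
have [MS _] := bS; have lS := ca_linear cM MS.
have [f [pf fA] gE] : Apure_states dot M A g by case: Pg => -[].
have sf := pf.1.
have A0 : A <> 0 by move=> A0; move: fA; rewrite A0 (state0 hdot hM sf) eqxx.
have ASE := Abounded_ker A0 bS.
have e1 h : A (T (S h)) = l *: A (S h) - A h.
  have := congr1 (@^~ h) eS1; change (A (l *: S h - T (S h)) = A h -> A (T (S h)) = l *: A (S h) - A h).
  by rewrite (linB lA) (linZ lA) => <-; rewrite subKr.
have e2 h : A (S (T h)) = l *: A (S h) - A h.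
  have := congr1 (@^~ h) eS2; change (A (S (l *: h - T h)) = A h -> A (S (T h)) = l *: A (S h) - A h).
  by rewrite (linB lS) (linZ lS) (linB lA) (linZ lA) => <-; rewrite subKr.
pose S0 := op_sqrt dot A \o (D \o S \o D) \o op_sqrt dot A.
have cS0 : sqrt_corner dot M A S0.
  by exists (D \o S \o D) => //; apply: (ca_comp cM) => //; exact: ca_comp.
have S0E h : S0 h = S (h - E h) - E (S (h - E h)).
  rewrite /S0 sqrtA.
  change (C (D (S (D (C (h - E h)))) - E (D (S (D (C (h - E h)))))) = S (h - E h) - E (S (h - E h))).
  by rewrite !DC (linB lC) -EC !CD.
have [MS0 _ _] := sqrt_cornerP cS0.
have AS0 h : A (S0 h) = A (S h) by rewrite S0E AP (linB lS) (linB lA) ASE subr0.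
have r1 : A \o T \o S0 = l *: (A \o S0) - A.
  apply/funext => h; change (A (T (S0 h)) = l *: A (S0 h) - A h).
  rewrite AS0 S0E ATP e1 AP; congr (l *: _ - _).
  by rewrite (linB lS) (linB lA) ASE subr0.
have r2 : A \o S0 \o T = l *: (A \o S0) - A.
  by apply/funext => h; change (A (S0 (T h)) = l *: A (S0 h) - A h); rewrite !AS0 e2.
have gX : g (l *: (A \o S0) - A) = l * g (A \o S0) - 1.
  rewrite -gE /=; have MAS := ca_comp cM MA MS0; rewrite (stateB hdot hM sf)//; last exact: (ca_Z cM).
  by rewrite (stateZ hdot hM sf)// mulrBl divff// mulrA.
have : l * g (A \o S0) - 1 = l * g (A \o S0).
  by case: Pg => -[_ /(_ _ cS0)]; rewrite ?r1 ?r2 gX gT.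
by move/eqP; rewrite -subr_eq0 addrAC subrr sub0r oppr_eq0 oner_eq0.
Qed.

End Fixed.
End Core.

(** * The theorem *)

Section Main.
Context {R : realType} {H : completeNormedModType R[i]}.
Variables (dot : {dot H for Num.conj}) (hdot : hilbert_dot dot).
Variables (M : set (H -> H)) (hM : von_neumann_algebra dot M).
Implicit Types (x y h : H) (S T L A X Y N : H -> H).
Local Notation rdot := (rdot dot).
Local Notation selfadj := (selfadj dot).
Local Notation pos := (positive_operator dot).
Local Notation I := (idfun : H -> H).
Let cM : closed_algebra M := vna_closed_algebra hdot hM.

Lemma Anorm_root A B : (forall h, A h = B (B h)) -> selfadj B ->
  forall h, Anorm dot A h = rnorm (B h).
Proof.
move=> AB sB h; rewrite /Anorm -rdotE AB sB -(rnorm_sqr hdot).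
by rewrite sqrtr_sqr ger0_norm ?rnorm_ge0.
Qed.

Lemma Aspectrum_eq A : M A -> A <> 0 -> pos A -> well_supported M A ->
  forall T, Abounded dot M A T ->
    Aspectrum dot M A T = [set g (A \o T) | g in PA dot M A T].
Proof.
move=> MA A0 pA wA T bT.
have [al al0 gap] := gap_of_well_supported hdot cM MA pA wA.
have [E [C [D [gE gC gD [sE sC pC sD] [EE AE CD DC AC]]]]] := gap_structure hdot pA al0 gap.
have bA := pA.1; have cG := generated_algebra_closed bA.
have ME := gE M cM MA; have MC := gC M cM MA; have MD := gD M cM MA.
have lE := ca_linear cM ME; have lC := ca_linear cM MC.
have EC := generated_algebra_comm bA gE gC.
pose B : H -> H := C \o (I - E).
have gB : generated_algebra A B by apply: (ca_comp cG gC); exact: (ca_B cG (ca_id cG) gE).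
have BE h : B h = C (h - E h) by [].
have sB : selfadj B.
  by move=> x y; rewrite !BE sC (linB lC) -EC rdotBl rdotBr sE.
have EB h : E (B h) = 0 by rewrite BE EC (linB lE) EE subrr (lin0 lC).
have BB h : B (B h) = A h by rewrite [B (B h)]BE EB subr0 BE -AC.
have pB : pos B.
  apply: nonneg_positive => //; first exact: (ca_bd cG gB).
  move=> h; suff -> : rdot (B h) h = rdot (C (h - E h)) (h - E h) by exact: pC.
  by rewrite -BE rdotBr -sE EB rdot0l subr0.
have sqrtA : op_sqrt dot A = B.
  by apply: (op_sqrt_eq hdot gB pB); apply/funext.
have normA h : Anorm dot A h = rnorm (C (h - E h)).
  by apply: (@Anorm_root A B) => // x; rewrite BB.
have ATE := Abounded_ker hdot hM ME MC EE AC normA A0 bT.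
have MT := bT.1.
apply/seteqP; split=> l.
  move=> nA; have [g Pg gT] := exists_PA_of_not_Ainvertible hdot hM MA ME MC MD sC sD
    EE AE CD DC EC AC sqrtA normA MT ATE nA.
  by exists g.
by move=> [g Pg gT]; exact: (PA_not_Ainvertible hdot hM MA ME MC MD EE AE CD DC EC AC
  sqrtA normA MT ATE Pg gT).
Qed.

Lemma Abounded_id T : M T -> Abounded dot M I T.
Proof.
move=> MT; split=> //.
have nI h : Anorm dot I h = rnorm h by exact: (@Anorm_root I I).
have [_ [k k0 bk]] := bounded_operator_bound (ca_bd cM MT).
apply: (@le_lt_trans _ _ (k%:E)%E); last exact: ltry.
apply: ge_ereal_sup => _ [h h1 <-]; rewrite lee_fin nI.
by have := bk h; rewrite -(nI h) h1 mulr1.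
Qed.

(** Every element of [M] is bounded for the seminorm of the identity, which is the
    norm. *)
Lemma spectrum_eq_Aspectrum T : spectrum M T = Aspectrum dot M I T.
Proof.
apply/seteqP; split=> l h [S hS e]; apply: h; exists S => //.
  by case: hS.
exact: Abounded_id.
Qed.

Lemma id_well_supported : well_supported M I.
Proof.
have sub l : spectrum M I l -> l = 1.
  move=> h; apply: contrapT => l1; apply: h.
  have l1' : l - 1 != 0 by rewrite subr_eq0; apply/eqP.
  exists ((l - 1)^-1 *: I); first by apply: (ca_Z cM); exact: ca_id.
  split; apply/funext => h.
    change (l *: ((l - 1)^-1 *: h) - (l - 1)^-1 *: h = h).
    rewrite -{2}[_ *: h]scale1r -scalerBl scalerA mulfV ?scale1r//.
  change ((l - 1)^-1 *: (l *: h - h) = h).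
  by rewrite -{2}[h]scale1r -scalerBl scalerA mulVf ?scale1r.
rewrite /well_supported.
have [s1|s1] := pselect (spectrum M I 1).
  rewrite (_ : _ `\ _ = [set 1 : R[i]^o]).
    exact: (accessible_closed_set1 (hausdorff_accessible (@norm_hausdorff _ R[i]^o))).
  apply/seteqP; split=> l /=; first by move=> [/sub].
  by move=> ->; split=> //= /eqP; rewrite oner_eq0.
rewrite (_ : _ `\ _ = set0); first exact: closed0.
by apply/seteqP; split=> l // [sl _]; apply: s1; rewrite -(sub l sl).
Qed.

End Main.

Theorem theorem2p7 (R : realType) (H : completeNormedModType R[i])
    (dot : {dot H for Num.conj}) (hdot : hilbert_dot dot)
    (M : set (H -> H)) (hM : von_neumann_algebra dot M) :
  (forall A : H -> H, M A -> A <> (0 : H -> H) -> positive_operator dot A ->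
     well_supported M A ->
     forall T : H -> H, Abounded dot M A T ->
       Aspectrum dot M A T = [set g (A \o T) | g in PA dot M A T])
  /\
  (forall T : H -> H, M T ->
     spectrum M T = [set g T | g in PA dot M idfun T]).
Proof.
split; first exact: Aspectrum_eq.
move=> T MT; have cM := vna_closed_algebra hdot hM.
have M1 := ca_id cM.
have [id0|idn0] := pselect ((idfun : H -> H) = 0); last first.
  rewrite (spectrum_eq_Aspectrum hdot hM).
  apply: (Aspectrum_eq hdot hM) => //.
  - by split=> [|h]; [exact: (ca_bd cM)|rewrite (dot_diag hdot) ler0c sqr_ge0].
  - exact: id_well_supported.
  - exact: Abounded_id.
(* on the zero space all operators coincide: [idfun] is an inverse of each, and a
   state would take the value [1] at [0] *)
have all0 (S S' : H -> H) : S = S'.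
  have z h : h = 0 :> H by exact: (congr1 (@^~ h) id0).
  by apply/funext => h; rewrite (z (S h)) (z (S' h)).
apply/seteqP; split=> l.
  by case; exists idfun => //; split; exact: all0.
move=> [g Pg _]; have [f [pf fA] _] : Apure_states dot M idfun g by case: Pg => -[].
by move: fA; rewrite id0 (state0 hdot hM pf.1) eqxx.
Qed.
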